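(* Let $\Omega$ be an open bounded convex subset of $\mathbb{R}^2$. Assume that $F:\mathcal{K}^2\to[0,+\infty)$ satisfies the following conditions. (H1) Domain monotonicity: for all $\Omega_1,\Omega_2\in\mathcal{K}^2$, $\Omega_1\subseteq\Omega_2$ implies $F(\Omega_1)\le F(\Omega_2)$. (H2) Homogeneity: there exists $\alpha>0$ such that $F(tK)=t^{\alpha}F(K)$ for every $t>0$ and every $K\in\mathcal{K}^2$. (H3) Behaviour on polygons: setting, for every integer $n\ge 3$, $$\gamma(n):=\min\{F(P)\,|P|^{-\alpha/2} : P \text{ an } n\text{-gon in } \mathcal{K}^2\},$$ one has (i) $\gamma(6)=F(H)$; (ii) it is possible to extend $\gamma$ to a function defined on $[3,+\infty)$ (still denoted $\gamma$) which is continuous at the point $6$ and is such that, for some $k_0\in\mathbb{N}$ and $\delta_0>0$, for all $k\ge k_0$, all $\delta$ with $0<\delta\le\delta_0$ and all integers $n_1,\dots,n_k\ge 3$, $$\frac1k\sum_{i=1}^k n_i\le 6+\delta\ \Longrightarrow\ \frac1k\sum_{i=1}^k\gamma(n_i)^{-2/\alpha}\le\gamma(6+\delta)^{-2/\alpha}.$$ For $k\in\mathbb{N}$ let $$m_k(\Omega)=\inf\Big\{\max_{i=1,\dots,k}F(P_i\cap\Omega) : \{P_i\}\in\mathcal{P}_k(\Omega)\Big\}.$$ Then $$\lim_{k\to+\infty}\frac{k^{\alpha/2}}{|\Omega|^{\alpha/2}}\,m_k(\Omega)=F(H).$$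
   Context: $\mathcal{K}^2$ is the family of convex bodies in $\mathbb{R}^2$, i.e. convex compact subsets of the plane with nonempty interior. $|\cdot|$ denotes area (Lebesgue measure). $H$ is the regular hexagon of unit area. An $n$-gon in $\mathcal{K}^2$ is a convex polygon with $n$ sides. $\mathcal{P}_k(\Omega)$ is the class of convex $k$-partitions of $\Omega$: families $\{P_i\}_{i=1,\dots,k}$ of subsets of $\mathbb{R}^2$ such that each $P_i$ is a polygon in $\mathcal{K}^2$, $\bigcup_i(P_i\cap\overline\Omega)=\overline\Omega$, and $|P_i\cap P_j|=0$ for every $i\ne j$. Since $F$ is defined on convex bodies, $F(P_i\cap\Omega)$ means $F$ evaluated at the closure of $P_i\cap\Omega$, and it is understood that each $P_i\cap\Omega$ has nonempty interior.
   Formalization: Since the regular hexagon H is determined only up to congruence and F is not assumed invariant, (i) is required for every regular hexagon of unit area in the plane (with one fixed H the claim fails, e.g. F(K)=max of |x| on K); Ω is taken nonempty. *)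

(* Defs.v *)
From mathcomp Require Import all_boot all_order all_algebra.
From mathcomp Require Import all_classical all_reals all_analysis.

Set Implicit Arguments.
Unset Strict Implicit.
Unset Printing Implicit Defensive.

Import Order.TTheory GRing.Theory Num.Theory.
Import numFieldNormedType.Exports.

Local Open Scope classical_set_scope.
Local Open Scope ring_scope.

Definition plane_measure (R : realType) : set (R * R) -> \bar R :=
  ((@lebesgue_measure R) \x (@lebesgue_measure R))%E.

(* Only meant for sets of finite measure: [fine] sends +oo to 0. *)
Definition area (R : realType) (A : set (R * R)) : R := fine (plane_measure A).

Definition convex_hull (R : realType) (A : set (R * R)) : set (R * R) :=
  smallest (@convex_set R (R * R)%type) A.

Definition convex_body (R : realType) (K : set (R * R)) : Prop :=
  [/\ @convex_set R (R * R)%type K, compact K & K° !=set0].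

(* The points [v i] are in convex position, hence are exactly the vertices of
   their hull; a convex polygon has as many sides as vertices. Nonempty
   interior forces [3 <= n]. *)
Definition is_ngon (R : realType) (n : nat) (P : set (R * R)) : Prop :=
  convex_body P /\
  exists v : 'I_n -> R * R,
    P = convex_hull (range v) /\
    forall i, ~ convex_hull (v @` [set j | j != i]) (v i).

Definition is_polygon (R : realType) (P : set (R * R)) : Prop :=
  exists n : nat, (3 <= n)%N /\ is_ngon n P.

Definition regular_hexagon (R : realType) (H : set (R * R)) : Prop :=
  exists (c : R * R) (r theta : R), 0 < r /\
    H = convex_hull (range (fun i : 'I_6 =>
          c + r *: (cos (theta + i%:R * (2 * pi / 6)),
                    sin (theta + i%:R * (2 * pi / 6))))).

(* "The" regular hexagon of unit area is determined up to congruence; this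
   predicate holds of all its positions in the plane. *)
Definition unit_hexagon (R : realType) (H : set (R * R)) : Prop :=
  regular_hexagon H /\ area H = 1.

Definition is_min (R : realType) (A : set R) (m : R) : Prop :=
  A m /\ lbound A m.

Definition convex_partition (R : realType) (Omega : set (R * R)) (k : nat)
    (P : 'I_k -> set (R * R)) : Prop :=
  [/\ forall i, is_polygon (P i),
      \bigcup_i (P i `&` closure Omega) = closure Omega,
      forall i j, i != j -> plane_measure (P i `&` P j) = 0%E &
      forall i, (P i `&` Omega)° !=set0].

(* [F] is nonnegative on convex bodies, so 0 is a harmless default for the
   maximum of a nonempty family. *)
Definition minmax_value (R : realType) (F : set (R * R) -> R)
    (Omega : set (R * R)) (k : nat) : R :=
  inf [set \big[Num.max/0]_(i < k) F (closure (P i `&` Omega))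
        | P in @convex_partition R Omega k].

(* Main.v *)
Require Import Defs.
From mathcomp Require Import all_boot all_order all_algebra.
From mathcomp Require Import all_classical all_reals all_analysis.
From mathcomp Require Import ring lra zify.
Import Order.TTheory GRing.Theory Num.Theory.
Import numFieldNormedType.Exports.
Local Open Scope classical_set_scope.
Local Open Scope ring_scope.

(** Why the theorem holds. Write [m_k] for the minimal value among partitions
    into [k] cells.

    Upper bound. Tile the plane by regular hexagons of area slightly larger
    than [area Omega / k]. For large [k] at most [k] of them meet [Omega],
    because those that do fit without overlap into a slightly enlarged copy of
    [Omega] ([hexagonal_partition]). They form a partition on which, by
    monotonicity, [F] is at most its value on one hexagon, that is,
    [(area Omega / k) `^ (alpha / 2) * F H] up to a factor close to [1]
    ([F_hexagon]). Cutting cells in two until there are exactly [k] of them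
    does not increase [F] ([refine_partition]). This gives [upper_bound].

    Lower bound. Replace [Omega] by a polygon [W] inside it with almost the
    same area ([inner_polygon]), and cut every cell of a given partition by
    [W]. The pieces are polygons with [n_i] sides that tile [W], and the total
    number of sides is at most [6 * k] plus a constant that depends only on [W]
    ([partition_cells]). If [M] bounds [F] on the cells, the definition of
    [gamma] bounds the area of a piece by a power of [M] times
    [gamma (n_i) `^ (- (2 / alpha))]; the assumption on averages of these
    powers then bounds the area of [W] in terms of [M], [k] and
    [g (6 + delta)], for any [delta > 0] and large [k] ([lower_bound]).

    The bound on the number of sides is usually obtained from Euler's formula.
    Here it is proved by a sweep ([vertex_count]). Along a direction in general
    position each cell has one first and one last vertex. At any other of its
    vertices the cell occupies one of the two sides of the sweeping line, so at
    most two cells are in this position at a given point; and if the point is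
    not a corner of [W], some cell begins or ends there
    ([eventless_vertex_extreme]). Hence the other vertices are at most twice as
    many as the [2 * k] first and last ones, up to the corners of [W].

    Polygons are handled through their extreme points: a convex body is the
    hull of its extreme points ([sub_of_extreme]), and intersections of two
    bodies with finitely many extreme points are again of this kind
    ([finite_extremeI]). *)

(** * Convex sets of the plane *)

Section PlaneConvexity.
Context {R : realType}.
Local Notation point := (R * R)%type.
Implicit Types (A K V : set point) (p q u v x y : point).

Definition dot u x : R := u.1 * x.1 + u.2 * x.2.
Arguments dot : simpl never.
Definition perp u : point := (- u.2, u.1).

(** Same as [convex_set], with the weight a bare real number instead of an
    element of the unit-interval type, so that linear arithmetic applies to
    it. *)
Definition convex A := forall x y (t : R), 0 <= t -> t <= 1 -> A x -> A y ->
  A (t *: x + (1 - t) *: y).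

Lemma dotD u x y : dot u (x + y) = dot u x + dot u y.
Proof. by rewrite /dot /=; ring. Qed.
Lemma dotZ u (t : R) x : dot u (t *: x) = t * dot u x.
Proof. by rewrite /dot /= /GRing.scale /=; ring. Qed.
Lemma dotB u x y : dot u (x - y) = dot u x - dot u y.
Proof. by rewrite /dot /=; ring. Qed.
Lemma dotN u x : dot u (- x) = - dot u x.
Proof. by rewrite /dot /=; ring. Qed.
Definition dotE := (dotD, dotB, dotN, dotZ).

Lemma dot_self_gt0 u : u != 0 -> 0 < dot u u.
Proof.
move=> u0; rewrite /dot.
have [h|h] := eqVneq u.1 0; last first.
  by rewrite ltr_wpDr// -expr2 ?sqr_ge0// lt_neqAle eq_sym sqrf_eq0 h sqr_ge0.
have [h2|h2] := eqVneq u.2 0; last first.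
  by rewrite ltr_wpDl// -expr2 ?sqr_ge0// lt_neqAle eq_sym sqrf_eq0 h2 sqr_ge0.
by case: u u0 h h2 => a b /= /negP u0 ? ?; subst; case: u0; apply/eqP.
Qed.

Lemma convexP A : @convex_set R point A <-> convex A.
Proof.
split=> cA x y t.
  move=> t0 t1 Ax Ay.
  have t01 : Itv.spec (@Itv.num_sem R) (Itv.Real `[0%Z, 1%Z]) t.
    by rewrite /Itv.spec /Itv.num_sem /= num_real /= in_itv /= t0 t1.
  have := cA x y (Itv.mk t01); rewrite !inE => /(_ Ax Ay).
  by [].
rewrite !inE => Ax Ay; have := cA x y t%:num; apply => //.
Qed.

Lemma interiorP A p : A° p <->
  exists2 r : R, 0 < r & forall x, `|x.1 - p.1| < r -> `|x.2 - p.2| < r -> A x.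
Proof.
split.
  move=> /nbhs_ballP[r /= r0 rA]; exists r => // x x1 x2; apply: rA.
  by split; rewrite -ball_normE /= distrC.
move=> [r r0 rA]; apply/nbhs_ballP; exists r => //= x [].
by rewrite -!ball_normE /= => x1 x2; apply: rA; rewrite distrC.
Qed.

(** A ball around [x] inside [K], shrunk by the factor [t] towards [y], is a
    ball around the combination and still lies in [K]. *)
Lemma convex_interior_mix K x y (t : R) : convex K -> K° x -> K y ->
  0 < t -> t <= 1 -> K° (t *: x + (1 - t) *: y).
Proof.
move=> cK /interiorP[r r0 rK] Ky t0 t1; apply/interiorP; exists (t * r).
  exact: mulr_gt0.
move=> z z1 z2.
pose w := t^-1 *: (z - (1 - t) *: y).
have tn : t != 0 by rewrite gt_eqF.
have -> : z = t *: w + (1 - t) *: y by rewrite /w scalerA divff// scale1r subrK.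
apply: cK => //; first exact: ltW.
have wE (a b c : R) : t^-1 * (a - (1 - t) * b) - c = t^-1 * (a - (t * c + (1 - t) * b)).
  by field; exact: tn.
have small (a b c : R) : `|a - (t * c + (1 - t) * b)| < t * r ->
    `|t^-1 * (a - (1 - t) * b) - c| < r.
  by move=> h; rewrite wE normrM gtr0_norm ?invr_gt0// ltr_pdivrMl.
by apply: rK; apply: small.
Qed.

Lemma convex_interior K : convex K -> convex K°.
Proof.
move=> cK x y t t0 t1 Kx Ky.
have [->|tn0] := eqVneq t 0; first by rewrite scale0r add0r subr0 scale1r.
apply: convex_interior_mix => //; last by rewrite lt_neqAle eq_sym tn0.
exact: interior_subset Ky.
Qed.

Lemma hull_convex V : convex (convex_hull V).
Proof.
move=> x y t t0 t1 hx hy C [/= cC VC].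
by move/convexP: (cC); apply => //; [apply: hx|apply: hy].
Qed.
Lemma sub_hull V : V `<=` convex_hull V.
Proof. exact: sub_gen_smallest. Qed.
Lemma hull_sub V A : convex A -> V `<=` A -> convex_hull V `<=` A.
Proof. by move=> cA VA; apply: smallest_sub => //; apply/convexP. Qed.

Lemma convexI A1 A2 : convex A1 -> convex A2 -> convex (A1 `&` A2).
Proof. by move=> c1 c2 x y t t0 t1 [x1 x2] [y1 y2]; split; [apply: c1|apply: c2]. Qed.

Lemma segmentE x y (t : R) : t *: x + (1 - t) *: y = y + t *: (x - y).
Proof. by rewrite scalerBl scale1r scalerBr addrC addrA addrAC. Qed.

(** The midpoint form of extremality; for a convex set it is equivalent to not
    lying inside any segment of the set, and it only mentions vectors. *)
Definition extreme K p := K p /\ forall v, K (p + v) -> K (p - v) -> v = 0.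

Lemma extreme_notint K p : extreme K p -> ~ K° p.
Proof.
move=> [_ ep] /interiorP[r r0 rK].
have r2 : `|r / 2| < r by rewrite ger0_norm; lra.
have : (r / 2, 0) = 0 :> point.
  apply: ep; apply: rK => /=.
  - by rewrite addrAC subrr add0r.
  - by rewrite addr0 subrr normr0.
  - by rewrite addrAC subrr add0r normrN.
  - by rewrite subr0 subrr normr0.
by case; lra.
Qed.

(** This is how extremality of a point is used against hulls: whatever
    generates [K] must contain [p], since [K] deprived of [p] is still convex.
    *)
Lemma extreme_setD1_convex K p : convex K -> extreme K p -> convex (K `\ p).
Proof.
move=> cK [Kp ep] x y t t0 t1 [Kx /= xp] [Ky /= yp]; split; first exact: cK.
rewrite /= segmentE => E.
have seg s : 0 <= s -> s <= 1 -> K (y + s *: (x - y)).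
  by move=> s0 s1; rewrite -segmentE; apply: cK.
have tn0 : t != 0 by apply: contra_notN yp => /eqP t0'; rewrite -E t0' scale0r addr0.
have tn1 : t != 1.
  by apply: contra_notN xp => /eqP t1'; rewrite -E t1' scale1r addrC subrK.
have t0' : 0 < t by rewrite lt_neqAle eq_sym tn0.
have t1' : t < 1 by rewrite lt_neqAle tn1.
set s := t * (1 - t).
have s0 : 0 < s by rewrite mulr_gt0// subr_gt0.
have st : s <= t by rewrite /s ler_piMr// lerBlDr lerDl ltW.
have s1 : s <= 1 - t by rewrite /s ler_piMl// subr_ge0 ltW.
have : s *: (x - y) = 0.
  apply: ep; rewrite -E -addrA.
    by rewrite -scalerDl; apply: seg; lra.
  by rewrite -scalerBl; apply: seg; lra.
move/eqP; rewrite scaler_eq0 gt_eqF//= subr_eq0 => /eqP xy.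
by apply: yp; rewrite -E xy subrr scaler0 addr0.
Qed.

Lemma extreme_hull V : extreme (convex_hull V) `<=` V.
Proof.
move=> p ep; apply: contrapT => Vp.
have VK : V `<=` convex_hull V `\ p.
  by move=> x Vx; split; [exact: sub_hull|move=> /= xp; apply: Vp; rewrite -xp].
have [//|_ /=] := hull_sub _ _ (extreme_setD1_convex _ _ (hull_convex V) ep) VK p.
  by case: ep.
exact.
Qed.
End PlaneConvexity.
Arguments dot : simpl never.

(** * Separating an open convex set from a point *)

Section Support.
Context {R : realType}.
Local Notation point := (R * R)%type.
Implicit Types (A C K V : set point) (p q u v w x y : point).

Lemma dot_perp u : dot u (perp u) = 0.
Proof. by rewrite /dot /=; ring. Qed.

Lemma decompose w x : w != 0 ->
  x = (dot (perp w) x / dot w w) *: perp w + (dot w x / dot w w) *: w.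
Proof.
move=> /dot_self_gt0 w0; have wn : dot w w != 0 by rewrite gt_eqF.
rewrite [LHS]surjective_pairing [RHS]surjective_pairing /= /GRing.scale /=.
by congr (_, _); move: wn; rewrite /dot /=; set a := w.1; set b := w.2 => wn; field.
Qed.

(** The planar Hahn-Banach theorem, proved without compactness. Fix [w] in [C]
    and the normal [n] to [w]. In the cone over [C], the slopes [s] for which
    [n + s *: w] is in the cone and the slopes [s'] for which [- n + s' *: w]
    is in the cone satisfy [0 <= s + s'], because otherwise the sum of the two
    vectors and a positive multiple of [w] would be opposite. The infimum of
    the first kind of slopes is the slope of a separating line. *)
Lemma open_convex_half C : convex C -> open C -> ~ C 0 ->
  exists2 u, u != 0 & forall x, C x -> 0 <= dot u x.
Proof.
move=> cC oC C0.
have [[w Cw]|Ce] := pselect (C !=set0); last first.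
  exists (1, 0); first by apply/eqP => -[]; lra.
  by move=> x Cx; case: Ce; exists x.
have w0 : w != 0 by apply: contra_notN C0 => /eqP <-.
pose n := perp w.
pose cone x := exists2 t : R, 0 < t & C (t *: x).
have coneD x y : cone x -> cone y -> cone (x + y).
  move=> [s s0 Cx] [t t0 Cy]; exists (s * t / (s + t)); first by rewrite divr_gt0 ?mulr_gt0 ?addr_gt0.
  have st : s + t != 0 by rewrite gt_eqF// addr_gt0.
  have -> : (s * t / (s + t)) *: (x + y) =
     (t / (s + t)) *: (s *: x) + (1 - t / (s + t)) *: (t *: y).
    rewrite !scalerA scalerDr; congr (_ *: _ + _ *: _); first by field.
    by field.
  apply: cC => //; first by rewrite divr_ge0// ?addr_ge0// ltW.
  by rewrite ler_pdivrMr ?addr_gt0//; lra.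
have coneZ x (t : R) : 0 < t -> cone x -> cone (t *: x).
  move=> t0 [s s0 Cx]; exists (s / t); first exact: divr_gt0.
  by rewrite scalerA -mulrA mulVf ?mulr1// gt_eqF.
have cone0 x : cone x -> cone (- x) -> False.
  move=> h1 h2; have [t t0] := coneD _ _ h1 h2; rewrite subrr scaler0; exact: C0.
have coneC x : C x -> cone x by exists 1; rewrite ?scale1r.
have cw := coneC _ Cw.
have near (z : point) : exists2 e : R, 0 < e & C (w + e *: z).
  have /interiorP[r r0 rC] : C° w by exact: oC.
  pose m := 1 + `|z.1| + `|z.2|.
  have m0 : 0 < m by rewrite /m; move: (normr_ge0 z.1) (normr_ge0 z.2); lra.
  exists (r / m); first exact: divr_gt0.
  apply: rC; rewrite /= addrC addKr normrM gtr0_norm ?divr_gt0//.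
    by rewrite mulrAC ltr_pdivrMr// ltr_pM2l// /m; move: (normr_ge0 z.1) (normr_ge0 z.2); lra.
  by rewrite mulrAC ltr_pdivrMr// ltr_pM2l// /m; move: (normr_ge0 z.1) (normr_ge0 z.2); lra.
(* the two sets of slopes of the cone on either side of the ray of [w] *)
pose S1 := [set s : R | cone (n + s *: w)].
pose S2 := [set s : R | cone (- n + s *: w)].
have [s1 h1] : exists s, S1 s.
  have [e e0 Ce] := near n; exists e^-1.
  rewrite /S1 /=; have := coneZ _ e^-1 _ (coneC _ Ce).
  by rewrite scalerDr scalerA mulVf ?gt_eqF// scale1r addrC; apply; rewrite invr_gt0.
have [s2 h2] : exists s, S2 s.
  have [e e0 Ce] := near (- n); exists e^-1.
  rewrite /S2 /=; have := coneZ _ e^-1 _ (coneC _ Ce).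
  by rewrite scalerDr scalerA mulVf ?gt_eqF// scale1r addrC; apply; rewrite invr_gt0.
have S12 a b : S1 a -> S2 b -> 0 <= a + b.
  move=> ha hb; have := coneD _ _ ha hb.
  rewrite addrACA subrr add0r -scalerDl => h; rewrite leNgt; apply/negP => ab.
  have ab' : 0 < (- (a + b))^-1 by rewrite invr_gt0 oppr_gt0.
  have := coneZ _ _ ab' h; rewrite scalerA invrN mulNr mulVf ?lt_eqF// scaleN1r.
  exact: cone0.
pose m := inf S1.
have S1i : has_inf S1.
  by split; [exists s1|exists (- s2) => a /S12 /(_ h2); lra].
have m1 a : S1 a -> m <= a by move=> ?; exact: ge_inf S1i.2 _ _.
have m2 b : S2 b -> - b <= m.
  by move=> hb; apply: lb_le_inf; [exact: S1i.1|move=> a /S12/(_ hb); lra].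
have ww := dot_self_gt0 _ w0.
have nw : dot w n = 0 by rewrite dot_perp.
(* the functional that vanishes on [n + m *: w] and is positive on [w] *)
exists (w - m *: n).
  apply/eqP => e; have : dot w (w - m *: n) = 0 by rewrite e /dot /=; ring.
  by rewrite !dotE nw; lra.
move=> x Cx.
have nn : dot n n = dot w w by rewrite /n /perp /dot /=; ring.
set a := dot (perp w) x / dot w w; set b := dot w x / dot w w.
have xE : x = a *: n + b *: w by exact: decompose.
have -> : dot (w - m *: n) x = (b - m * a) * dot w w.
  rewrite {1}xE !dotE.
  have -> : dot (w - m *: n) n = - m * dot w w by rewrite -nn; move: nw; rewrite /dot /= /GRing.scale /=; lra.
  have -> : dot (w - m *: n) w = dot w w by move: nw; rewrite /dot /= /GRing.scale /=; lra.
  by ring.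
rewrite mulr_ge0 ?(ltW ww)//.
have cx := coneC _ Cx; rewrite xE in cx.
have [a0|a0|a0] := ltgtP a 0.
- have a0' : 0 < (- a)^-1 by rewrite invr_gt0 oppr_gt0.
  have an : a != 0 by rewrite lt_eqF.
  have /m2 : S2 (b / - a).
    have := coneZ _ _ a0' cx; rewrite scalerDr !scalerA [_ * b]mulrC.
    by rewrite invrN mulNr mulVf// scaleN1r.
  by rewrite -mulNr ler_pdivrMr ?oppr_gt0//; lra.
- have a0' : 0 < a^-1 by rewrite invr_gt0.
  have /m1 : S1 (b / a).
    have := coneZ _ _ a0' cx; rewrite scalerDr !scalerA [_ * b]mulrC.
    by rewrite mulVf ?gt_eqF// scale1r.
  by rewrite ler_pdivlMr//; lra.
- rewrite a0 mulr0 subr0 leNgt; apply/negP => b0.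
  rewrite a0 scale0r add0r in cx.
  have b0' : 0 < (- b)^-1 by rewrite invr_gt0 oppr_gt0.
  have := coneZ _ _ b0' cx; rewrite scalerA invrN mulNr mulVf ?lt_eqF// scaleN1r.
  exact: cone0.
Qed.
End Support.

(** * Supporting lines, faces and extreme points *)

Section Faces.
Context {R : realType}.
Local Notation point := (R * R)%type.
Implicit Types (A C K V : set point) (p q u v w x y : point).

Lemma continuous_dot u : continuous (dot u).
Proof.
move=> x; rewrite /dot; apply: cvgD; apply: cvgM; try exact: cvg_cst.
  exact: cvg_fst.
exact: cvg_snd.
Qed.

Lemma closed_level u (c : R) : closed [set x | dot u x = c].
Proof.
have -> : [set x | dot u x = c] = dot u @^-1` [set c] by [].
apply: preimage_closed; first by move=> x _; exact: continuous_dot.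
by apply: compact_closed; [exact: norm_hausdorff|exact: compact_set1].
Qed.

Lemma interior_direction K p z : K° p ->
  exists2 e : R, 0 < e & forall t : R, `|t| <= e -> K (p + t *: z).
Proof.
move=> /interiorP[r r0 rK].
pose m := 1 + `|z.1| + `|z.2|.
have m0 : 0 < m by rewrite /m; move: (normr_ge0 z.1) (normr_ge0 z.2); lra.
exists (r / m) => [|t te]; first exact: divr_gt0.
have small (a : R) : `|a| < m -> `|t * a| < r.
  move=> am; rewrite normrM; have [->|t0] := eqVneq t 0; first by rewrite normr0 mul0r.
  rewrite (lt_le_trans (y := `|t| * m))// ?ltr_pM2l ?normr_gt0//.
  by rewrite -ler_pdivlMr.
by apply: rK; rewrite /= addrC addKr; apply: small; rewrite /m; move: (normr_ge0 z.1) (normr_ge0 z.2); lra.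
Qed.

(** Separation of [0] from the open convex set of all [p - x] with [x]
    interior to [K]; points of [K] that are not interior are reached by mixing
    them with an interior point and letting the weight of the latter tend to
    [0]. *)
Lemma support_line K p : convex K -> K° !=set0 -> ~ K° p ->
  exists2 u, u != 0 & forall x, K x -> dot u x <= dot u p.
Proof.
move=> cK [w Kw] Kp.
have [| |/=|u u0 uC] := open_convex_half [set x | K° (p - x)].
- move=> x y t t0 t1 /= Kx Ky.
  have -> : p - (t *: x + (1 - t) *: y) = t *: (p - x) + (1 - t) *: (p - y).
    rewrite !scalerBr addrACA -scalerDl -opprD; congr (_ - _).
    by rewrite addrC subrK scale1r.
  exact: convex_interior.
- move=> x /= Kx.
  have /interiorP[r r0 rK] : (K°)° (p - x).
    by move: Kx; apply: (@open_interior _ K).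
  apply/interiorP; exists r => // y y1 y2 /=; apply: rK.
    by rewrite /= opprB addrC addrA subrK -normrN opprD opprK addrC.
  by rewrite /= opprB addrC addrA subrK -normrN opprD opprK addrC.
- by rewrite subr0.
exists u => // x Kx; rewrite leNgt; apply/negP => lt.
set D := dot u x - dot u p.
have D0 : 0 < D by rewrite subr_gt0.
set E := dot u w - dot u x.
have key (t : R) : 0 < t -> t <= 1 -> t * E <= - D.
  move=> t0 t1; have := uC (p - (t *: w + (1 - t) *: x)).
  rewrite /= opprB addrC subrK.
  by move=> /(_ (convex_interior_mix _ _ _ _ cK Kw Kx t0 t1)); rewrite !dotE /E /D; lra.
have [E0|E0] := lerP 0 E; first by have := key 1 ltr01 (lexx _); lra.
(* a weight so small that the term in [E] cannot compensate the gap [D] *)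
pose t := D / (2 * (D - E)).
have t0 : 0 < t by rewrite divr_gt0//; lra.
have t1 : t <= 1 by rewrite ler_pdivrMr; lra.
have := key _ t0 t1.
have tE : t * (2 * (D - E)) = D by rewrite /t divfK//; apply/eqP; lra.
have := mulr_gt0 t0 D0; lra.
Qed.

Lemma dot_perp_eq0 u v : u != 0 -> dot u v = 0 -> dot (perp u) v = 0 -> v = 0.
Proof.
by move=> u0 h1 h2; rewrite (decompose u v u0) h1 h2 !mul0r !scale0r addr0.
Qed.

Lemma compact_dot_max K u : compact K -> K !=set0 ->
  exists2 a, K a & forall x, K x -> dot u x <= dot u a.
Proof.
move=> cK K0; have := @compact_EVT_max _ R (dot u) K K0 cK.
move=> []; first by apply: continuous_subspaceT => x; exact: continuous_dot.
by move=> a /[!inE] Ka aK; exists a => // x Kx; apply: aK; rewrite inE.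
Qed.

(** The points of [K] where the functional is maximal form a compact subset of
    a line. Its two ends, which maximize [perp u] and [- perp u] on it, are
    extreme in [K], and [p] lies between them. *)
Lemma extreme_face K u p : compact K -> u != 0 -> K p ->
    (forall x, K x -> dot u x <= dot u p) ->
  exists a b (t : R), [/\ extreme K a, extreme K b, 0 <= t <= 1,
    p = t *: a + (1 - t) *: b & dot u a = dot u p /\ dot u b = dot u p].
Proof.
move=> cK u0 Kp pK.
pose Fc := K `&` [set x | dot u x = dot u p].
have cF : compact Fc by apply: compact_closedI => //; exact: closed_level.
have F0 : Fc !=set0 by exists p.
have ext h a : h = perp u \/ h = - perp u -> Fc a -> (forall x, Fc x -> dot h x <= dot h a) -> extreme K a.
  move=> hE [Ka au] amax; split => // v Kv1 Kv2.
  have uv : dot u v = 0.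
    by move: (pK _ Kv1) (pK _ Kv2); move: au => /=; rewrite !dotE; lra.
  have hv : dot h v = 0.
    have F1 : Fc (a + v) by split => //=; rewrite dotE uv addr0.
    have F2 : Fc (a - v) by split => //=; rewrite !dotE uv subr0.
    by move: (amax _ F1) (amax _ F2); rewrite !dotE; lra.
  apply: (dot_perp_eq0 u) => //; move: hv; case: hE => -> //.
  by rewrite /dot /= => h0; lra.
have [a Fa amax] := compact_dot_max Fc (perp u) cF F0.
have [b Fb bmin] := compact_dot_max Fc (- perp u) cF F0.
have ea : extreme K a by apply: (ext (perp u)) => //; left.
have eb : extreme K b by apply: (ext (- perp u)) => //; right.
have pa : dot (perp u) p <= dot (perp u) a by exact: amax.
have dN x : dot (- perp u) x = - dot (perp u) x by rewrite /dot /=; ring.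
have pb : dot (perp u) b <= dot (perp u) p by have := bmin p (conj Kp erefl); rewrite !dN; lra.
case: Fa Fb => Ka /= ua [Kb /= ub].
have [E|E] := eqVneq (dot (perp u) a) (dot (perp u) b).
  exists a, b, 1; split => //; first by lra.
  rewrite scale1r subrr scale0r addr0; apply/eqP; rewrite -subr_eq0; apply/eqP.
  by apply: (dot_perp_eq0 u) => //; rewrite !dotE; lra.
set D := dot (perp u) a - dot (perp u) b.
have D0 : 0 < D by rewrite /D subr_gt0 lt_neqAle eq_sym E /=; lra.
pose t := (dot (perp u) p - dot (perp u) b) / D.
have tD : t * D = dot (perp u) p - dot (perp u) b by rewrite divfK// gt_eqF.
exists a, b, t; split => //.
  by apply/andP; split; [rewrite divr_ge0//; lra|rewrite ler_pdivrMr//; rewrite /D; lra].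
rewrite segmentE; apply/eqP; rewrite -subr_eq0; apply/eqP.
apply: (dot_perp_eq0 u) => //; rewrite !dotE; first by rewrite ua ub; lra.
by move: tD; rewrite /D; lra.
Qed.

Lemma boundary_point K p : convex K -> compact K -> K° !=set0 -> K p -> ~ K° p ->
  exists a b (t : R), [/\ extreme K a, extreme K b, 0 <= t <= 1 &
    p = t *: a + (1 - t) *: b].
Proof.
move=> cK kK K0 Kp Kp'; have [u u0 uK] := support_line K p cK K0 Kp'.
by have [a [b [t [? ? ? ? _]]]] := extreme_face K u p kK u0 Kp uK; exists a, b, t.
Qed.

(** Minkowski's theorem: a convex body is the convex hull of its extreme
    points. A boundary point lies on a face, hence between two extreme points;
    an interior point lies between the two boundary points at the ends of the
    horizontal chord through it. *)
Lemma sub_of_extreme K C : convex K -> compact K -> K° !=set0 -> convex C ->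
  extreme K `<=` C -> K `<=` C.
Proof.
move=> cK kK K0 cC eC x Kx.
have bd y : K y -> ~ K° y -> C y.
  move=> Ky Ky'; have [a [b [t [ea eb /andP[t0 t1] ->]]]] := boundary_point K y cK kK K0 Ky Ky'.
  by apply: cC => //; exact: eC.
have [Kx'|] := pselect (K° x); last exact: bd.
pose L := K `&` [set y | dot (0, 1) y = dot (0, 1) x].
have kL : compact L by apply: compact_closedI => //; exact: closed_level.
have L0 : L !=set0 by exists x.
have out d y : (d = 1 \/ d = -1) -> L y -> (forall z, L z -> dot (d, 0) z <= dot (d, 0) y) -> C y.
  move=> dE [Ky /= yx] ymax; apply: bd => // Ki; have [e e0 eK] := interior_direction K y (d, 0) Ki.
  have Le : L (y + e *: (d, 0)).
    split; first by apply: eK; rewrite gtr0_norm.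
    by move: yx => /=; rewrite /dot /= /GRing.scale /= => ?; lra.
  move: (ymax _ Le); rewrite dotD dotZ {2}/dot /= mulr0 addr0.
  have -> : d * d = 1 by case: dE => ->; ring.
  lra.
have [a La amax] := compact_dot_max L (1, 0) kL L0.
have [b Lb bmax] := compact_dot_max L (-1, 0) kL L0.
have Ca : C a by apply: (out 1) => //; left.
have Cb : C b by apply: (out (-1)) => //; right.
have xa := amax x (conj Kx erefl); have xb := bmax x (conj Kx erefl).
case: La Lb => _ /= a2 [_ /= b2].
move: a2 b2 xa xb; rewrite /dot /= => a2 b2 xa xb.
have [E|E] := eqVneq a.1 b.1.
  have -> : x = a by rewrite [LHS]surjective_pairing [RHS]surjective_pairing; congr (_, _); lra.
  exact: Ca.
have D0 : 0 < a.1 - b.1 by rewrite subr_gt0 lt_neqAle eq_sym E /=; lra.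
pose t := (x.1 - b.1) / (a.1 - b.1).
have tD : t * (a.1 - b.1) = x.1 - b.1 by rewrite divfK// gt_eqF.
have -> : x = t *: a + (1 - t) *: b.
  rewrite [LHS]surjective_pairing [RHS]surjective_pairing /= /GRing.scale /=.
  have E2 : a.2 = b.2 by lra.
  by congr (_, _); [lra|rewrite E2; lra].
apply: cC => //; first by rewrite divr_ge0//; lra.
by rewrite ler_pdivrMr//; lra.
Qed.
End Faces.

(** * Polygons *)

Section Polygons.
Context {R : realType}.
Local Notation point := (R * R)%type.
Implicit Types (A C K V : set point) (p q u v w x y a b c d : point).

Lemma scaled_between K x v (e : R) : convex K -> K x -> K (x + v) ->
  0 <= e -> e <= 1 -> K (x + e *: v).
Proof.
move=> cK Kx Kv e0 e1; have := cK _ _ e e0 e1 Kv Kx.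
by rewrite segmentE addrAC subrr add0r.
Qed.

(** Whether a point is extreme is decided near that point, so intersecting
    with a set [C] that contains a small segment through the point in the
    direction [v] creates no extreme point there. *)
Lemma extreme_local K C x v (e : R) : convex K -> extreme (C `&` K) x ->
  0 < e -> (forall t : R, `|t| <= e -> C (x + t *: v)) ->
  K (x + v) -> K (x - v) -> v = 0.
Proof.
move=> cK [[Cx Kx] ex] e0 eC K1 K2.
pose s := Num.min e 1.
have s0 : 0 < s by rewrite lt_min e0 ltr01.
have s1 : s <= 1 by rewrite ge_min lexx orbT.
have se : `|s| <= e by rewrite gtr0_norm// ge_min lexx.
have : s *: v = 0.
  apply: ex; split.
  - exact: eC.
  - by apply: scaled_between => //; exact: ltW.
  - by rewrite -scaleNr; apply: eC; rewrite normrN.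
  - by rewrite -scalerN; apply: scaled_between => //; exact: ltW.
by move/eqP; rewrite scaler_eq0 gt_eqF//= => /eqP.
Qed.

Lemma extreme_interior K C x : convex K -> extreme (C `&` K) x -> C° x ->
  extreme K x.
Proof.
move=> cK eCK Cx; split; first by case: eCK => -[].
move=> v K1 K2; have [e e0 eC] := interior_direction C x v Cx.
exact: extreme_local eCK e0 eC K1 K2.
Qed.

Lemma open_segment_room K a b x (t : R) : convex K -> K a -> K b ->
  0 < t -> t < 1 -> x = t *: a + (1 - t) *: b ->
  exists2 e : R, 0 < e & forall s : R, `|s| <= e -> K (x + s *: (a - b)).
Proof.
move=> cK Ka Kb t0 t1 ->; exists (Num.min t (1 - t)).
  by rewrite lt_min t0 subr_gt0.
move=> s; rewrite le_min !ler_norml => /andP[/andP[h1 h2] /andP[h3 h4]].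
rewrite segmentE -addrA -scalerDl -segmentE; apply: cK => //; lra.
Qed.

(** Cramer's formula for the intersection of the lines [(a b)] and [(c d)]. *)
Definition meet_lines (z : point * point * (point * point)) : point :=
  let: (a, b, (c, d)) := z in
  let n := perp (c - d) in b + (dot n (d - b) / dot n (a - b)) *: (a - b).

(** The intersection of two polygons is a polygon. An extreme point of [K `&`
    C] in the interior of one of the sets is extreme in the other one.
    Otherwise it lies on an edge of each; if it is a vertex of neither, the
    two edges cannot be parallel, since a common small segment would contain
    the point, and it is one of the finitely many points where two such edges
    meet. *)
Lemma finite_extremeI K C : convex K -> convex C -> compact K -> compact C ->
  K° !=set0 -> C° !=set0 ->
  finite_set (extreme K) -> finite_set (extreme C) ->
  finite_set (extreme (K `&` C)).
Proof.
move=> cK cC kK kC K0 C0 fK fC.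
have fX : finite_set (meet_lines @`
    ((extreme K `*` extreme K) `*` (extreme C `*` extreme C))).
  by apply/finite_image/finite_setX; apply: finite_setX.
apply: (@sub_finite_set _ _ ((extreme K `|` extreme C) `|` meet_lines @`
    ((extreme K `*` extreme K) `*` (extreme C `*` extreme C)))); last first.
  by rewrite !finite_setU.
move=> x ex; have [[Kx Cx] _] := ex.
have [iK|iK] := pselect (K° x).
  by left; right; apply: extreme_interior iK.
have [iC|iC] := pselect (C° x).
  by left; left; apply: extreme_interior iC => //; rewrite setIC.
have [a [b [t [ea eb /andP[t0 t1] xE]]]] := boundary_point K x cK kK K0 Kx iK.
have [c [d [s [ec ed /andP[s0 s1] xE']]]] := boundary_point C x cC kC C0 Cx iC.
have [t0'|tn0] := eqVneq t 0.
  by left; left; rewrite xE t0' scale0r add0r subr0 scale1r.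
have [t1'|tn1] := eqVneq t 1.
  by left; left; rewrite xE t1' subrr scale0r addr0 scale1r.
have [s0'|sn0] := eqVneq s 0.
  by left; right; rewrite xE' s0' scale0r add0r subr0 scale1r.
have [s1'|sn1] := eqVneq s 1.
  by left; right; rewrite xE' s1' subrr scale0r addr0 scale1r.
have tp : 0 < t by rewrite lt_neqAle eq_sym tn0.
have tq : t < 1 by rewrite lt_neqAle tn1.
have sp : 0 < s by rewrite lt_neqAle eq_sym sn0.
have sq : s < 1 by rewrite lt_neqAle sn1.
have [cd|cd] := eqVneq c d.
  by left; right; rewrite xE' cd -scalerDl addrC subrK scale1r.
have [ab|ab] := eqVneq a b.
  by left; left; rewrite xE ab -scalerDl addrC subrK scale1r.
have w0 : c - d != 0 by rewrite subr_eq0.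
pose n := perp (c - d).
have [par|npar] := eqVneq (dot n (a - b)) 0.
  have [e e0 eK] := open_segment_room K a b x t cK ea.1 eb.1 tp tq xE.
  have [f f0 fC'] := open_segment_room C c d x s cC ec.1 ed.1 sp sq xE'.
  have abE := decompose (c - d) (a - b) w0.
  rewrite -/n par mul0r scale0r add0r in abE.
  set l := _ / _ in abE.
  have ln0 : l != 0.
    by apply: contra_neq ab => l0; apply/eqP; rewrite -subr_eq0 abE l0 scale0r.
  have l0 : 0 < `|l| by rewrite normr_gt0.
  pose r := Num.min e (f / `|l|).
  have r0 : 0 < r by rewrite lt_min e0 divr_gt0.
  have rin (z : R) : `|z| = r -> (K `&` C) (x + z *: (a - b)).
    move=> zr; split; first by apply: eK; rewrite zr ge_min lexx.
    rewrite abE scalerA; apply: fC'.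
    by rewrite normrM -ler_pdivlMr// zr ge_min lexx orbT.
  have : r *: (a - b) = 0.
    apply: ex.2; first by apply: rin; rewrite gtr0_norm.
    by rewrite -scaleNr; apply: rin; rewrite normrN gtr0_norm.
  by move/eqP; rewrite scaler_eq0 gt_eqF//= subr_eq0 (negbTE ab).
right; exists ((a, b), (c, d)) => //=.
rewrite -/n xE segmentE; congr (_ + _ *: _).
apply: (mulIf npar); rewrite divfK//.
have h1 : dot n x = dot n b + t * dot n (a - b) by rewrite xE segmentE dotD dotZ.
have h2 : dot n x = dot n d + s * dot n (c - d) by rewrite xE' segmentE dotD dotZ.
have h3 : dot n (c - d) = 0 by rewrite /n /dot /perp /=; ring.
by move: h1 h2; rewrite h3 mulr0 addr0 => ->; have := dotB n d b; lra.
Qed.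

Lemma plane_compact_closed K : compact K -> closed K.
Proof. by apply: compact_closed; exact: norm_hausdorff. Qed.

Lemma body_convex K : convex_body K -> convex K.
Proof. by case=> /convexP. Qed.

Lemma ngon_extreme n K : is_ngon n K -> finite_set (extreme K).
Proof.
move=> [_ [v [-> _]]]; apply: (@sub_finite_set _ _ (range v)).
  exact: extreme_hull.
by apply: finite_image; exact: finite_finset.
Qed.

Lemma body_not_in_line K u (c : R) : K° !=set0 -> u != 0 ->
  ~ (forall x, K x -> dot u x = c).
Proof.
move=> [p Kp] u0 Kc; have [e e0 eK] := interior_direction K p u Kp.
have := Kc _ (eK e _); rewrite gtr0_norm// lexx => /(_ isT).
rewrite dotD (Kc p (interior_subset Kp)) dotZ => h.
have := mulr_gt0 e0 (dot_self_gt0 u u0); lra.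
Qed.

(** Minkowski's theorem shows that [K] is the hull of the listed points, and
    they are in convex position because they are extreme. Fewer than three
    points would lie on a line, which has no interior. *)
Lemma extreme_ngon K (s : seq point) : convex_body K -> uniq s ->
  (forall x, x \in s <-> extreme K x) -> (3 <= size s)%N /\ is_ngon (size s) K.
Proof.
move=> bK us sK; have cK := body_convex K bK; case: (bK) => _ kK K0.
have line u (c : R) : u != 0 -> ~ (forall x, x \in s -> dot u x = c).
  move=> u0 sc; apply: (body_not_in_line K u c) => //.
  have : K `<=` [set x | dot u x = c].
    apply: sub_of_extreme => //; last by move=> x /sK; exact: sc.
    by move=> x y t _ _ /=; rewrite dotD !dotZ => -> ->; ring.
  exact.
split.
  move: line {us sK}; case: s => [|a [|b [|c s]]] // line.
  - by case: (line (1, 0) 0) => //; apply/eqP => -[] /eqP; rewrite oner_eq0.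
  - case: (line (1, 0) (dot (1, 0) a)); first by apply/eqP => -[] /eqP; rewrite oner_eq0.
    by move=> x; rewrite inE => /eqP ->.
  - have [ab|ab] := eqVneq a b.
      case: (line (1, 0) (dot (1, 0) a)); first by apply/eqP => -[] /eqP; rewrite oner_eq0.
      by move=> x; rewrite ab !inE orbb => /eqP ->.
    case: (line (perp (b - a)) (dot (perp (b - a)) a)).
      apply/eqP => -[h1 h2]; case/eqP: ab; rewrite [a]surjective_pairing [b]surjective_pairing.
      by congr (_, _); lra.
    by move=> x; rewrite !inE => /orP[]/eqP -> //; rewrite /dot /perp /=; ring.
split=> //; pose v (i : 'I_(size s)) := nth 0 s i.
have vK i : extreme K (v i) by apply/sK; exact: mem_nth.
exists v; split.
  apply/seteqP; split.
    apply: sub_of_extreme => //; first exact: hull_convex.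
    move=> x ex; apply: sub_hull; move: (ex) => /sK xs.
    have xi : (index x s < size s)%N by rewrite index_mem.
    by exists (Ordinal xi) => //; rewrite /v /= nth_index.
  by apply: hull_sub => // _ [i _ <-]; exact: (vK i).1.
move=> i hi; have cKi := extreme_setD1_convex K (v i) cK (vK i).
have [||_ /=] := hull_sub (v @` [set j | j != i]) _ cKi _ (v i); last exact; last exact: hi.
move=> _ [j /= ji <-]; split; first exact: (vK j).1.
by move=> /= /eqP; rewrite nth_uniq ?(negbTE ji)// => /eqP /val_inj ?; subst; rewrite eqxx in ji.
Qed.

(** Polygons are used below only through their extreme points, which behave
    well under intersection. *)
Lemma polygonP K : is_polygon K <-> convex_body K /\ finite_set (extreme K).
Proof.
split; first by move=> [n [_ nK]]; split; [case: nK|exact: ngon_extreme nK].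
move=> [bK /finite_seqP [s0 sE]]; pose s := undup s0.
have [||h1 h2] := extreme_ngon K s bK.
- exact: undup_uniq.
- by move=> x; rewrite mem_undup sE.
by exists (size s).
Qed.
End Polygons.

(** * Vertices met by a sweeping line *)

Section Counting.
Context {R : realType}.
Local Notation point := (R * R)%type.
Implicit Types (A C K : set point) (p q u v w x y a b c d : point).

(** Interior points accumulate at every point of [K]. *)
Lemma interior_above K u p : convex K -> K° !=set0 ->
  (exists2 x, K x & dot u p < dot u x) -> exists2 x, K° x & dot u p < dot u x.
Proof.
move=> cK [w Kw] [x Kx ux].
have [uw|uw] := ltP (dot u p) (dot u w); first by exists w.
(* the weight [t] of [w] leaves half of the excess of [x] over the level of
   [p] *)
pose D := 2 * (dot u x - dot u w).
have D0 : 0 < D by rewrite /D; lra.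
pose t := (dot u x - dot u p) / D.
have tD : t * D = dot u x - dot u p by rewrite divfK// gt_eqF.
have t0 : 0 < t by rewrite divr_gt0//; lra.
have t1 : t <= 1 by rewrite ler_pdivrMr// /D; lra.
exists (t *: w + (1 - t) *: x); first exact: convex_interior_mix.
by rewrite !dotE; move: tD; rewrite /D; lra.
Qed.

(** Interior points on either side of the level line through [p] are joined by
    a segment of interior points, and this segment crosses the line. *)
Lemma level_germ K u p : convex K -> K° !=set0 -> u != 0 ->
  (exists2 x, K x & dot u p < dot u x) -> (exists2 x, K x & dot u x < dot u p) ->
  exists e : R, K° (p + e *: perp u).
Proof.
move=> cK K0 u0 above [y Ky uy].
have [a Ka ua] := interior_above K u p cK K0 above.
have [|b Kb ub] := interior_above K (- u) p cK K0.
  by exists y => //; rewrite /dot /=; move: uy; rewrite /dot; lra.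
have {}ub : dot u b < dot u p by move: ub; rewrite /dot /=; lra.
pose t := (dot u p - dot u b) / (dot u a - dot u b).
have D0 : 0 < dot u a - dot u b by lra.
have tD : t * (dot u a - dot u b) = dot u p - dot u b by rewrite divfK// gt_eqF.
have t0 : 0 <= t by rewrite divr_ge0//; lra.
have t1 : t <= 1 by rewrite ler_pdivrMr//; lra.
pose z := t *: a + (1 - t) *: b.
have Kz : K° z by exact: convex_interior.
have uz : dot u (z - p) = 0 by rewrite /z !dotE; lra.
exists (dot (perp u) (z - p) / dot u u).
have := decompose u (z - p) u0; rewrite uz mul0r scale0r addr0 => <-.
by rewrite addrC subrK.
Qed.

Lemma interior_meet K C p : convex C -> C° !=set0 -> K° p -> C p ->
  exists2 x, K° x & C° x.
Proof.
move=> cC [w Cw] Kp Cp.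
have Kp' : (K°)° p by move: Kp; apply: (@open_interior _ K).
have [e e0 eK] := interior_direction _ p (w - p) Kp'.
pose t := Num.min e 1.
have t0 : 0 < t by rewrite lt_min e0 ltr01.
exists (p + t *: (w - p)); first by apply: eK; rewrite gtr0_norm// ge_min lexx.
by rewrite -segmentE; apply: convex_interior_mix => //; rewrite ge_min lexx orbT.
Qed.

(** If near [p] the closed set [K] fills one side of a line through [p], then
    it contains a small segment of that line around [p]. *)
Lemma half_ball_not_extreme K p n : closed K -> n != 0 ->
  ([set x | dot n p < dot n x -> K x])° p -> ~ extreme K p.
Proof.
move=> clK n0 near [Kp ep]; pose m := perp n.
have nm : dot n m = 0 by rewrite dot_perp.
have side (s : R) : s = 1 \/ s = -1 ->
    exists2 e : R, 0 < e & forall t, 0 < t -> t <= e -> K (p + (s * t) *: m).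
  move=> sE.
  have near' : ([set x | dot n p < dot n x -> K x]°)° p.
    by move: near; apply: (@open_interior _ [set x | dot n p < dot n x -> K x]).
  have [e e0 eK] := interior_direction _ p m near'.
  exists e => // t t0 te; apply: contrapT => Kt.
  have oK : (~` K)° (p + (s * t) *: m) by exact: (closed_openC clK).
  have nKt : [set x | dot n p < dot n x -> K x]° (p + (s * t) *: m).
    by apply: eK; rewrite normrM (gtr0_norm t0); case: sE => ->; rewrite ?normrN normr1 mul1r.
  have [e1 e10 eK1] := interior_direction _ _ n oK.
  have [e2 e20 eK2] := interior_direction _ _ n nKt.
  pose r := Num.min e1 e2.
  have r0 : 0 < r by rewrite lt_min e10.
  have r1 : `|r| <= e1 by rewrite gtr0_norm// ge_min lexx.
  have r2 : `|r| <= e2 by rewrite gtr0_norm// ge_min lexx orbT.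
  apply: (eK1 _ r1); apply: (eK2 _ r2); rewrite !dotE nm.
  by have := mulr_gt0 r0 (dot_self_gt0 n n0); lra.
have [e1 e10 K1] := side 1 (or_introl erefl).
have [e2 e20 K2] := side (-1) (or_intror erefl).
pose t := Num.min e1 e2.
have t0 : 0 < t by rewrite lt_min e10.
have : t *: m = 0.
  apply: ep.
    by have := K1 t t0; rewrite mul1r; apply; rewrite ge_min lexx.
  by have := K2 t t0; rewrite mulN1r scaleNr; apply; rewrite ge_min lexx orbT.
move/eqP; rewrite scaler_eq0 gt_eqF//= => /eqP m0.
have mm : dot m m = dot n n by rewrite /dot /m /perp /=; ring.
by have := dot_self_gt0 n n0; rewrite -mm m0 /dot /= mul0r addr0 ltxx.
Qed.

Section Cells.
Context {I : finType}.
Variables (Q : I -> set point) (W : set point).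
Hypotheses (cQ : forall i, convex (Q i)) (kQ : forall i, compact (Q i))
  (Q0 : forall i, (Q i)° !=set0)
  (disQ : forall i j x, (Q i)° x -> (Q j)° x -> i = j)
  (cW : convex W) (QW : forall i, Q i `<=` W)
  (WQ : forall x, W x -> exists i, Q i x).

(** For [p] in the convex cell [Q i], an equivalent form of: the interior of
    the cell contains an initial open segment of the ray from [p] in the
    direction [d]. *)
Definition germ d i p := exists2 e : R, 0 < e & (Q i)° (p + e *: d).

(** If [p] and [p + f *: d] belong to a convex cell, the second one being
    interior, the open segment between them is interior; so two cells that
    occupy the same ray overlap. *)
Lemma germ_inj d i j p : Q i p -> Q j p -> germ d i p -> germ d j p -> i = j.
Proof.
have aux i' j' (e f : R) : 0 < e -> e <= f -> Q j' p -> (Q i')° (p + e *: d) ->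
    (Q j')° (p + f *: d) -> i' = j'.
  move=> e0 ef Qj Qi' Qj'; have f0 : 0 < f by exact: lt_le_trans ef.
  apply: (disQ _ _ (p + e *: d)) => //.
  have -> : p + e *: d = (e / f) *: (p + f *: d) + (1 - e / f) *: p.
    by rewrite segmentE addrAC subrr add0r scalerA divfK// gt_eqF.
  apply: convex_interior_mix => //; first exact: divr_gt0.
  by rewrite ler_pdivrMr// mul1r.
move=> Qi Qj [e e0 Ei] [f f0 Fj]; have [ef|/ltW fe] := leP e f.
  exact: aux ef Qj Ei Fj.
by apply/esym; exact: aux fe Qi Fj Ei.
Qed.

(** The cells are closed and finitely many, so the ones that do not contain
    [p] stay away from it. *)
Lemma near_cells p : ([set x | forall j, Q j x -> Q j p])° p.
Proof.
suff : \forall x \near nbhs p, forall j, Q j x -> Q j p by [].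
apply: filter_forall => j; have [Qj|Qj] := pselect (Q j p).
  by apply: filterE.
have : nbhs p (~` Q j) by apply: open_nbhs_nbhs; split => //; apply: closed_openC; exact: plane_compact_closed.
by apply: filterS => x /=.
Qed.

(** Sweep the plane by the level lines of [u]. If no cell starts or ends at
    [p], every cell at [p] crosses the level line of [p] and therefore
    occupies one of its two rays; by [germ_inj] there are at most two such
    cells. If there is a second cell [Q j] besides [Q i], then [p] is interior
    to [W] and near [p] the plane is covered by both. The side of a supporting
    line of [Q j] at [p] that [Q j] avoids must be filled by [Q i], which
    contradicts the extremality of [p] in [Q i]. So [Q i] is alone and [W]
    coincides with it near [p]. *)
Lemma eventless_vertex_extreme i p u : u != 0 -> extreme (Q i) p ->
  (forall j, Q j p -> (exists2 x, Q j x & dot u p < dot u x) /\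
     (exists2 x, Q j x & dot u x < dot u p)) ->
  extreme W p.
Proof.
move=> u0 ep noev; apply: contrapT => nW.
have Qip := ep.1; have Wp := QW _ _ Qip.
have nint j : Q j p -> ~ (Q j)° p.
  move=> Qjp Kj; have [x jx ix] := interior_meet _ _ p (cQ i) (Q0 i) Kj Qip.
  by have E := disQ _ _ _ jx ix; apply: (extreme_notint _ _ ep); rewrite -E.
have germs j : Q j p -> germ (perp u) j p \/ germ (- perp u) j p.
  move=> Qjp; have [h1 h2] := noev j Qjp.
  have [e Ke] := level_germ _ u p (cQ j) (Q0 j) u0 h1 h2.
  have [e0|e0|e0] := ltgtP e 0.
  - by right; exists (- e); rewrite ?oppr_gt0// scaleNr scalerN opprK.
  - by left; exists e.
  - by move: Ke; rewrite e0 scale0r addr0 => /nint; case.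
(* orient the level line so that [Q i] lies on the ray of [g] *)
have [g [gi gj]] : exists g, germ g i p /\ forall j, Q j p -> germ g j p \/ germ (- g) j p.
  case: (germs i Qip) => h; first by exists (perp u).
  exists (- perp u); split => // j /germs; rewrite opprK; tauto.
have [[j [ji Qjp]]|noj] := pselect (exists j, j <> i /\ Q j p).
  have gj' : germ (- g) j p.
    by case: (gj j Qjp) => // h; case: ji; exact: germ_inj Qjp Qip h gi.
  have all m : Q m p -> m = i \/ m = j.
    move=> Qm; case: (gj m Qm) => h; [left; exact: germ_inj Qm Qip h gi|right].
    exact: germ_inj Qm Qjp h gj'.
  have Wp' : W° p.
    have [e e0 Ke] := gi; have [f f0 Kf] := gj'.
    (* [p] lies between an interior point of [Q i] and one of [Q j] *)
    have ef : 0 < e + f by exact: addr_gt0.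
    have -> : p = (f / (e + f)) *: (p + e *: g) + (1 - f / (e + f)) *: (p + f *: - g).
      rewrite !scalerDr addrACA -scalerDl [f / _ + _]addrC subrK scale1r.
      rewrite !scalerN !scalerA -scalerBl.
      have -> : f / (e + f) * e - (1 - f / (e + f)) * f = 0 by field; rewrite gt_eqF.
      by rewrite scale0r addr0.
    apply: convex_interior => //.
    - by rewrite divr_ge0// ltW.
    - by rewrite ler_pdivrMr//; lra.
    - by apply: interiorS Ke; exact: QW.
    - by apply: interiorS Kf; exact: QW.
  have [n n0 nQ] := support_line _ p (cQ j) (Q0 j) (nint j Qjp).
  apply: (half_ball_not_extreme _ p n _ n0 _ ep); first exact: plane_compact_closed.
  apply: (interiorS _ (filterI Wp' (near_cells p))) => x [Wx nx] nlt.
  have [m Qm] := WQ _ Wx; case: (all m (nx m Qm)) => E; first by rewrite -E.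
  by move: Qm; rewrite E => /nQ; lra.
apply: nW; split => // v W1 W2.
have near : ([set x | W x -> Q i x])° p.
  apply: interiorS (near_cells p) => x nx Wx; have [m Qm] := WQ _ Wx.
  have [<-//|mi] := pselect (m = i); by case: noj; exists m; split => //; exact: nx.
have [e e0 eK] := interior_direction _ p v near.
pose t := Num.min e 1.
have t0 : 0 < t by rewrite lt_min e0 ltr01.
have t1 : t <= 1 by rewrite ge_min lexx orbT.
have te : `|t| <= e by rewrite gtr0_norm// ge_min lexx.
have : t *: v = 0.
  apply: ep.2.
    by apply: (eK _ te); apply: scaled_between => //; exact: ltW.
  rewrite -scaleNr; apply: eK; rewrite ?normrN// scaleNr -scalerN.
  by apply: scaled_between => //; exact: ltW.
by move/eqP; rewrite scaler_eq0 gt_eqF//= => /eqP.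
Qed.
End Cells.
End Counting.

(** * Counting the vertices of a partition *)

Section VertexCount.
Context {R : realType}.
Local Notation point := (R * R)%type.
Implicit Types (A C K : set point) (p q u v w x y a b c d : point).

(** The vector [(1, s)] takes equal values on [a] and [b] only if [s] is minus
    the ratio of the differences of their coordinates, which is avoided by a
    large [s]. *)
Lemma generic_direction (V : seq point) : exists2 u : point, u != 0 &
  forall a b, a \in V -> b \in V -> dot u a = dot u b -> a = b.
Proof.
pose f a b : R := `|a.1 - b.1| / `|a.2 - b.2|.
have f0 a b : 0 <= f a b by rewrite divr_ge0.
have sum_ge (h : point -> R) z : (forall y, 0 <= h y) -> z \in V ->
    h z <= \sum_(y <- V) h y.
  by move=> h0 zV; rewrite (big_rem z)//= lerDl sumr_ge0.
(* the sum dominates every single ratio *)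
pose s := 1 + \sum_(a <- V) \sum_(b <- V) f a b.
have fs a b : a \in V -> b \in V -> f a b < s.
  move=> aV bV; apply: (@le_lt_trans _ _ (\sum_(y <- V) f a y)).
    exact: (sum_ge (f a)).
  apply: (@le_lt_trans _ _ (\sum_(x <- V) \sum_(y <- V) f x y)).
    by apply: (sum_ge (fun x => \sum_(y <- V) f x y)) => // y; exact: sumr_ge0.
  by rewrite /s ltrDr.
exists (1, s); first by apply/eqP => -[] /eqP; rewrite oner_eq0.
move=> a b aV bV; rewrite /dot /= !mul1r => h.
have [E|E] := eqVneq a.2 b.2.
  by rewrite [a]surjective_pairing [b]surjective_pairing E; congr (_, _); move: h; rewrite E; lra.
have E0 : 0 < `|a.2 - b.2| by rewrite normr_gt0 subr_eq0.
have := fs a b aV bV; rewrite /f ltr_pdivrMr//.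
have -> : a.1 - b.1 = - (s * (a.2 - b.2)) by lra.
rewrite normrN normrM ltr_pM2r//.
by move/(le_lt_trans (ler_norm s)); rewrite ltxx.
Qed.

Lemma count_le1 (T : eqType) (P : pred T) (s : seq T) : uniq s ->
  (forall x y : T, x \in s -> y \in s -> P x -> P y -> x = y) -> (count P s <= 1)%N.
Proof.
move=> us Pinj; rewrite -size_filter.
have : uniq (seq.filter P s) by exact: filter_uniq.
have : forall x : T, x \in seq.filter P s -> P x && (x \in s) by move=> x; rewrite mem_filter.
case: (seq.filter P s) => [|x [|y t]] //= sP /andP[]; rewrite inE negb_or => /andP[/eqP xy _] _.
case: xy; have /andP[Px xs] := sP x (mem_head _ _).
have /andP[Py ys] : P y && (y \in s) by apply: sP; rewrite !inE eqxx orbT.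
exact: Pinj.
Qed.

Lemma sum_le1 (I : finType) (P : pred I) : (forall i j, P i -> P j -> i = j) ->
  (\sum_i P i <= 1)%N.
Proof.
move=> Pinj; rewrite -big_mkcond /= sum1_count; apply: count_le1.
  exact: index_enum_uniq.
by move=> i j _ _; exact: Pinj.
Qed.

(** This replaces Euler's formula. Choose a functional that is injective on
    all vertices. Each cell has at most one vertex where the functional is
    maximal and one where it is minimal on the cell; call these events, at
    most [2 * #|I|] in total. At every other vertex of a cell the cell
    occupies one of the two rays of the level line through it, so that a point
    is a non-event vertex of at most two cells. If it is one of some cell and
    is no corner of [W], then [eventless_vertex_extreme] provides an event at
    this point. Hence the non-event vertices number at most twice the events,
    plus two per corner of [W]. *)
Lemma vertex_count (I : finType) (Q : I -> set point) W (E : I -> seq point)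
    (EW : seq point) :
  (forall i, convex (Q i)) -> (forall i, compact (Q i)) ->
  (forall i, (Q i)° !=set0) ->
  (forall i j x, (Q i)° x -> (Q j)° x -> i = j) ->
  convex W -> (forall i, Q i `<=` W) -> (forall x, W x -> exists i, Q i x) ->
  (forall i, uniq (E i)) -> (forall i x, x \in E i <-> extreme (Q i) x) ->
  (forall x, extreme W x -> x \in EW) ->
  (\sum_i size (E i) <= 6 * #|I| + 2 * size EW)%N.
Proof.
move=> cQ kQ Q0 disQ cW QW WQ uE EQ EEW.
pose V := undup (flatten [seq E i | i <- enum I]).
have uV : uniq V by exact: undup_uniq.
have EV i p : p \in E i -> p \in V.
  move=> pE; rewrite mem_undup; apply/flattenP; exists (E i) => //.
  by apply/mapP; exists i; rewrite ?mem_enum.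
have [u u0 uinj] := generic_direction V.
pose top i p := `[< Q i p /\ forall x, Q i x -> dot u x <= dot u p >].
pose bot i p := `[< Q i p /\ forall x, Q i x -> dot u p <= dot u x >].
pose ev i p : nat := (top i p + bot i p)%N.
pose side i p := [&& p \in E i, ~~ top i p & ~~ bot i p].
have topN i p : Q i p -> ~~ top i p -> exists2 x, Q i x & dot u p < dot u x.
  move=> Qp /asboolPn h; apply: contrapT => h'; apply: h; split => // x Qx.
  by rewrite leNgt; apply/negP => ?; apply: h'; exists x.
have botN i p : Q i p -> ~~ bot i p -> exists2 x, Q i x & dot u x < dot u p.
  move=> Qp /asboolPn h; apply: contrapT => h'; apply: h; split => // x Qx.
  by rewrite leNgt; apply/negP => ?; apply: h'; exists x.
have ev2 i : (\sum_(p <- V) ev i p <= 2)%N.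
  rewrite big_split /= -!big_mkcond /= !sum1_count (leq_add (n1 := 1) (n2 := 1))//.
    apply: count_le1 => // x y xV yV /asboolP[Qx hx] /asboolP[Qy hy].
    by apply: uinj => //; apply/eqP; rewrite eq_le hx// hy.
  apply: count_le1 => // x y xV yV /asboolP[Qx hx] /asboolP[Qy hy].
  by apply: uinj => //; apply/eqP; rewrite eq_le hx// hy.
have sizeE i : size (E i) = (\sum_(p <- V) (p \in E i))%N.
  rewrite -big_mkcond /= sum1_count -size_filter; apply: perm_size.
  apply: uniq_perm; rewrite ?filter_uniq// => p; rewrite mem_filter.
  by have [/EV ->|] := boolP (p \in E i).
have split_E i p : ((p \in E i) <= side i p + ev i p)%N.
  by rewrite /side /ev; case: (p \in E i); case: (top i p); case: (bot i p).
have side2 p : (\sum_i side i p <= 2)%N.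
  pose g d i := `[< Q i p /\ germ Q d i p >].
  apply: (@leq_trans (\sum_i (g (perp u) i + g (- perp u) i))).
    apply: leq_sum => i _; case: (boolP (side i p)) => // /and3P[/EQ ep tp bp].
    have [e Ke] := level_germ _ u p (cQ i) (Q0 i) u0 (topN _ _ ep.1 tp) (botN _ _ ep.1 bp).
    have [e0|e0|e0] := ltgtP e 0.
    - suff -> : g (- perp u) i by rewrite addn1.
      by apply/asboolP; split; [exact: ep.1|exists (- e); rewrite ?oppr_gt0// scaleNr scalerN opprK].
    - suff -> : g (perp u) i by [].
      by apply/asboolP; split; [exact: ep.1|exists e].
    - by case: (extreme_notint _ _ ep); move: Ke; rewrite e0 scale0r addr0.
  rewrite big_split /= (leq_add (n1 := 1) (n2 := 1))//; apply: sum_le1 => i j /asboolP[Qi gi] /asboolP[Qj gj].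
    exact: (germ_inj Q cQ disQ (perp u) i j p).
  exact: (germ_inj Q cQ disQ (- perp u) i j p).
(* a corner of [W] is charged for both of its possible non-event cells *)
have key p : (\sum_i side i p <= 2 * \sum_i ev i p + 2 * (p \in EW))%N.
  have [|pEW] := boolP (p \in EW); first by rewrite muln1 => _; rewrite (leq_trans (side2 p))// leq_addl.
  rewrite muln0 addn0.
  have [[i si]|nos] := pselect (exists i, side i p); last first.
    rewrite big1// => i _; case: (boolP (side i p)) => // si; case: nos; by exists i.
  have [[j ej]|noe] := pselect (exists j, (0 < ev j p)%N).
    rewrite (leq_trans (side2 p))// -[X in (X <= _)%N]muln1 leq_mul2l /=.
    by rewrite (bigD1 j)//= (leq_trans ej)// leq_addr.
  have /and3P[/EQ ep _ _] := si.
  case/negP: pEW; apply: EEW; apply: (eventless_vertex_extreme Q W cQ kQ Q0 disQ cW QW WQ i p u u0 ep).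
  move=> j Qj; split; [apply: topN|apply: botN] => //; apply/negP => h; apply: noe; exists j;
    by rewrite /ev h ?addn1.
have -> : (\sum_i size (E i) = \sum_i \sum_(p <- V) (p \in E i))%N.
  by apply: eq_bigr => i _; exact: sizeE.
apply: (@leq_trans (\sum_i \sum_(p <- V) (side i p + ev i p))).
  by apply: leq_sum => i _; apply: leq_sum => p _; exact: split_E.
under eq_bigr do rewrite big_split.
rewrite big_split /=.
have evI : (\sum_i \sum_(p <- V) ev i p <= 2 * #|I|)%N.
  apply: (@leq_trans (\sum_(i : I) 2)); first by apply: leq_sum => i _; exact: ev2.
  by rewrite sum_nat_const mulnC.
have sideI : (\sum_i \sum_(p <- V) side i p <= 4 * #|I| + 2 * size EW)%N.
  rewrite exchange_big /=.
  apply: (@leq_trans (\sum_(p <- V) (2 * \sum_i ev i p + 2 * (p \in EW)))).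
    by apply: leq_sum => p _; exact: key.
  rewrite big_split /= -!big_distrr /= leq_add//.
    rewrite exchange_big /= (leq_trans (n := 2 * (2 * #|I|)))// ?leq_mul2l//=.
    by rewrite mulnA.
  rewrite leq_mul2l /= -big_mkcond /= sum1_count -size_filter.
  apply: uniq_leq_size; first exact: filter_uniq.
  by move=> p; rewrite mem_filter => /andP[].
by rewrite (leq_trans (leq_add sideI evI))// addnAC -mulnDl.
Qed.
End VertexCount.

(** * Lebesgue measure of the plane *)

Section PlaneMeasure.
Context {R : realType}.
Local Notation point := (R * R)%type.
Local Notation mR := (measurableTypeR R).
Local Notation leb := (@lebesgue_measure R).
Local Notation mu := (product_measure1 leb leb).
Implicit Types (A K : set point) (p q u v x y : point).

(** Measurability for the product of the two Borel sigma-algebras of the line,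
    the one on which [plane_measure] is a measure. *)
Definition plane_measurable A := measurable (A : set (mR * mR)).

Lemma plane_measureE A : plane_measure A = mu A.
Proof. by []. Qed.

Definition box (a b c d : R) : set point := `]a, b[%classic `*` `]c, d[%classic.

Lemma box_measurable a b c d : plane_measurable (box a b c d).
Proof. by apply: measurableX; exact: measurable_itv. Qed.

Lemma box_measure a b c d : a < b -> c < d ->
  plane_measure (box a b c d) = ((b - a) * (d - c))%:E.
Proof.
move=> ab cd; rewrite plane_measureE /box product_measure1E; try exact: measurable_itv.
rewrite [LHS](_ : _ = (leb `]a, b[%classic * leb `]c, d[%classic)%E)//.
by rewrite !lebesgue_measure_itv /= !lte_fin ab cd -!EFinB -EFinM.
Qed.

(** A neighbourhood of [p] contains a closed rectangle around [p] with
    rational sides; there are only countably many of these. *)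
Lemma open_rat_box A p : open A -> A p -> exists r : (rat * rat) * (rat * rat),
  [/\ ratr r.1.1 < p.1 < ratr r.1.2, ratr r.2.1 < p.2 < ratr r.2.2 &
   forall x, ratr r.1.1 <= x.1 <= ratr r.1.2 ->
     ratr r.2.1 <= x.2 <= ratr r.2.2 -> A x].
Proof.
move=> oA Ap; have /interiorP[e e0 eA] : A° p by exact: oA.
have pick (x : R) : exists a b : rat, x - e < ratr a < x /\ x < ratr b < x + e.
  have /rat_in_itvoo[a] : x - e < x by rewrite ltrBlDr ltrDl.
  rewrite in_itv /= => ha.
  have /rat_in_itvoo[b] : x < x + e by rewrite ltrDl.
  by rewrite in_itv /= => hb; exists a, b.
have [a [b [/andP[a1 a2] /andP[b1 b2]]]] := pick p.1.
have [c [d [/andP[c1 c2] /andP[d1 d2]]]] := pick p.2.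
exists ((a, b), (c, d)); split; rewrite /= ?a2 ?b1 ?c2 ?d1//.
move=> x /andP[x1 x2] /andP[y1 y2].
by apply: eA; rewrite ltr_norml; apply/andP; split; lra.
Qed.

Lemma open_plane_measurable A : open A -> plane_measurable A.
Proof.
move=> oA; pose C (r : (rat * rat) * (rat * rat)) : set point :=
  box (ratr r.1.1) (ratr r.1.2) (ratr r.2.1) (ratr r.2.2).
pose B r : set point := if `[< C r `<=` A >] then C r else set0.
have -> : A = \bigcup_r B r.
  apply/seteqP; split=> [p Ap|p [r _]].
    have [r [r1 r2 rA]] := open_rat_box A p oA Ap.
    exists r => //; rewrite /B asboolT; first by split; rewrite /= in_itv.
    move=> x [/=]; rewrite !in_itv /= => /andP[x1 x2] /andP[y1 y2].
    by apply: rA; rewrite !ltW.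
  by rewrite /B; case: asboolP => // rA; exact: rA.
apply: countable_bigcupT_measurable; first exact: countableP.
by move=> r; rewrite /B; case: ifP => _; [exact: box_measurable|exact: measurable0].
Qed.

Lemma closed_plane_measurable A : closed A -> plane_measurable A.
Proof.
by move=> /closed_openC /open_plane_measurable /measurableC; rewrite setCK.
Qed.

Lemma le_plane_measure A B : plane_measurable A -> plane_measurable B ->
  A `<=` B -> (plane_measure A <= plane_measure B)%E.
Proof. by move=> mA mB AB; apply: le_measure => //; rewrite inE. Qed.

Lemma open_measure_gt0 A : open A -> A !=set0 -> (0 < plane_measure A)%E.
Proof.
move=> oA [p Ap]; have /interiorP[e e0 eA] : A° p by exact: oA.
apply: (@lt_le_trans _ _ (plane_measure (box (p.1 - e) (p.1 + e) (p.2 - e) (p.2 + e)))).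
  by rewrite box_measure ?lte_fin ?mulr_gt0//; lra.
apply: le_plane_measure; [exact: box_measurable|exact: open_plane_measurable|].
move=> x [/=]; rewrite !in_itv /= => /andP[x1 x2] /andP[y1 y2].
by apply: eA; rewrite ltr_norml; apply/andP; split; lra.
Qed.

Lemma line_plane_measurable u (c : R) : plane_measurable [set x | dot u x = c].
Proof. by apply: closed_plane_measurable; exact: closed_level. Qed.

(** A line that is not vertical meets every vertical line in one point, so its
    sections are null; a vertical line is a product with a null factor. *)
Lemma line_measure0 u (c : R) : u != 0 -> plane_measure [set x | dot u x = c] = 0%E.
Proof.
move=> u0; rewrite plane_measureE.
have [u2|u2] := eqVneq u.2 0.
  have u1 : u.1 != 0.
    by apply: contra_neq u0 => u1; rewrite [u]surjective_pairing u1 u2.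
  have -> : [set x | dot u x = c] = [set c / u.1] `*` [set: R].
    apply/seteqP; split => x /=; rewrite /dot u2 mul0r addr0.
      by move=> <-; rewrite mulrC mulKf.
    by move=> [-> _]; rewrite mulrC divfK.
  rewrite product_measure1E; [|exact: measurable_set1|exact: measurableT].
  rewrite [LHS](_ : _ = (leb [set (c / u.1)%R] * leb setT)%E)//.
  by rewrite lebesgue_measure_set1 mul0e.
rewrite /product_measure1; apply: integral0_eq => x _ /=.
have -> : xsection [set x | dot u x = c] x = [set (c - u.1 * x) / u.2].
  apply/seteqP; split => y; rewrite /xsection /= inE /dot /=.
    by move=> <-; rewrite addrC addKr mulrC mulKf.
  by move=> ->; rewrite [u.2 * _]mulrC divfK// addrC subrK.
exact: lebesgue_measure_set1.
Qed.

Lemma open_half_plane u (c : R) : open [set x | dot u x < c].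
Proof.
have -> : [set x | dot u x < c] = dot u @^-1` [set y | y < c] by [].
by apply: open_comp; [move=> x _; exact: continuous_dot|exact: open_lt].
Qed.

(** In the affine coordinates [s] and [t] of the triangle [a b c], the
    inequalities [0 < s], [0 < t], [s + t < 1] cut out an open subset of [K],
    which contains the centroid. *)
Lemma three_points_interior K a b c : convex K -> K a -> K b -> K c ->
  dot (perp (b - a)) (c - a) != 0 -> K° !=set0.
Proof.
move=> cK Ka Kb Kc; set n := perp (b - a); set D := dot n (c - a) => D0.
pose m := perp (c - a).
have mb : dot m (b - a) = - D by rewrite /m /D /n /dot /perp /=; ring.
have mc : dot m (c - a) = 0 by rewrite /m /dot /perp /=; ring.
have nb : dot n (b - a) = 0 by rewrite /n /dot /perp /=; ring.
pose s x := dot (- D^-1 *: m) (x - a).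
pose t x := dot (D^-1 *: n) (x - a).
have sE x : s x = - D^-1 * dot m (x - a) by rewrite /s /dot /= /GRing.scale /=; ring.
have tE x : t x = D^-1 * dot n (x - a) by rewrite /t /dot /= /GRing.scale /=; ring.
have xE x : x = a + (s x *: (b - a) + t x *: (c - a)).
  apply/eqP; rewrite -subr_eq0 opprD addrA subr_eq0; apply/eqP.
  rewrite sE tE [LHS]surjective_pairing [RHS]surjective_pairing.
  move: D0; rewrite /D /m /n /dot /perp /= /GRing.scale /= => D0.
  by congr (_, _); field.
have sub x : 0 < s x -> 0 < t x -> s x + t x < 1 -> K x.
  move=> s0 t0 st; rewrite (xE x); set S := s x; set T := t x.
  have ST : 0 < S + T by exact: addr_gt0.
  have -> : a + (S *: (b - a) + T *: (c - a)) =
     (S + T) *: ((S / (S + T)) *: b + (1 - S / (S + T)) *: c) + (1 - (S + T)) *: a.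
    have STn : S + T != 0 by rewrite gt_eqF.
    rewrite [LHS]surjective_pairing [RHS]surjective_pairing /= /GRing.scale /=.
    by congr (_, _); field.
  apply: (cK) => //; [exact: ltW|exact: ltW|apply: (cK) => //].
    by rewrite divr_ge0// ltW.
  by rewrite ler_pdivrMr// mul1r lerDl ltW.
pose p := a + ((1/3) *: (b - a) + (1/3) *: (c - a)).
exists p.
have oS : open ([set x | dot (- (- D^-1 *: m)) x < - dot (- D^-1 *: m) a] `&`
     [set x | dot (- (D^-1 *: n)) x < - dot (D^-1 *: n) a] `&`
     [set x | dot (- D^-1 *: m + D^-1 *: n) x < 1 + dot (- D^-1 *: m + D^-1 *: n) a]).
  by apply: openI; [apply: openI|]; exact: open_half_plane.
have dNl u x : dot (- u) x = - dot u x by rewrite /dot /=; ring.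
have dDl u v x : dot (u + v) x = dot u x + dot v x by rewrite /dot /=; ring.
apply: (interiorS (A := ([set x | dot (- (- D^-1 *: m)) x < - dot (- D^-1 *: m) a] `&`
     [set x | dot (- (D^-1 *: n)) x < - dot (D^-1 *: n) a] `&`
     [set x | dot (- D^-1 *: m + D^-1 *: n) x < 1 + dot (- D^-1 *: m + D^-1 *: n) a]))).
  by move=> x [[/= h1 h2] h3]; apply: sub; rewrite /s /t !dotB; move: h1 h2 h3;
     rewrite !dDl ?dNl => h1 h2 h3; lra.
have pa : p - a = (1/3) *: (b - a) + (1/3) *: (c - a) by rewrite /p addrC addKr.
have sp : s p = 1/3.
  by rewrite sE pa dotD !dotZ mb mc mulr0 addr0 mulrCA mulrNN mulVf// mulr1.
have tp : t p = 1/3.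
  by rewrite tE pa dotD !dotZ nb mulr0 add0r mulrCA mulVf// mulr1.
apply: oS; move: sp tp; rewrite /s /t !dotB => sp tp.
by split; [split|]; rewrite /= ?dDl ?dNl; lra.
Qed.

(** Three points of [K] that are not collinear would span a triangle, which
    has interior. *)
Lemma flat_in_line K : convex K -> ~ (K° !=set0) ->
  exists u (c : R), u != 0 /\ K `<=` [set x | dot u x = c].
Proof.
move=> cK K0; have e10 : (1, 0) != 0 :> point by apply/eqP => -[] /eqP; rewrite oner_eq0.
have [[a Ka]|nK] := pselect (exists a, K a); last first.
  by exists (1, 0), 0; split => // x Kx; case: nK; exists x.
have [[b [Kb ba]]|nb] := pselect (exists b, K b /\ b != a); last first.
  exists (1, 0), (dot (1, 0) a); split => // x Kx /=.
  by have [->//|xa] := eqVneq x a; case: nb; exists x.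
exists (perp (b - a)), (dot (perp (b - a)) a); split.
  apply: contra_neq ba => -[h1 h2].
  by rewrite [a]surjective_pairing [b]surjective_pairing; congr (_, _); lra.
move=> x Kx /=; apply/eqP; rewrite -subr_eq0 -dotB; apply: contra_notT K0 => h.
exact: (three_points_interior K a b x).
Qed.

Lemma flat_measure0 K : convex K -> plane_measurable K -> ~ (K° !=set0) ->
  plane_measure K = 0%E.
Proof.
move=> cK mK K0; have [u [c [u0 Kl]]] := flat_in_line K cK K0.
apply/eqP; rewrite eq_le; apply/andP; split; last exact: measure_ge0.
rewrite -(line_measure0 u c u0); apply: le_plane_measure => //.
exact: line_plane_measurable.
Qed.
End PlaneMeasure.

(** * Area *)

Section Area.
Context {R : realType}.
Local Notation point := (R * R)%type.
Local Notation mR := (measurableTypeR R).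
Local Notation leb := (@lebesgue_measure R).
Local Notation mu := (product_measure1 leb leb).
Implicit Types (A K : set point) (p q u v x y z : point).

Lemma bounded_box A : bounded_set A -> exists2 M : R, 0 < M &
  A `<=` box (- M) M (- M) M.
Proof.
move=> /ex_strict_bound_gt0[M M0 /= MA]; exists M => // x Ax.
have := MA x Ax; rewrite prod_normE gt_max !ltr_norml => /andP[h1 h2].
by split; rewrite /= in_itv /=.
Qed.

Lemma bounded_measure_fin A : bounded_set A -> plane_measurable A ->
  plane_measure A \is a fin_num.
Proof.
move=> /bounded_box[M M0 AM] mA; rewrite ge0_fin_numE; last exact: measure_ge0.
apply: (le_lt_trans (le_plane_measure A _ mA (box_measurable _ _ _ _) AM)).
by rewrite box_measure ?ltry//; lra.
Qed.

Lemma areaE A : bounded_set A -> plane_measurable A ->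
  plane_measure A = (area A)%:E.
Proof. by move=> bA mA; rewrite fineK// bounded_measure_fin. Qed.

Lemma bounded_subset A B : A `<=` B -> bounded_set B -> bounded_set A.
Proof. by move=> AB; rewrite /bounded_set /bounded_near; apply: filterS => M h x Ax; apply: h; exact: AB. Qed.

Lemma area_gt0 A : bounded_set A -> plane_measurable A -> A° !=set0 -> 0 < area A.
Proof.
move=> bA mA A0; rewrite -lte_fin -areaE//.
apply: (lt_le_trans (open_measure_gt0 _ (open_interior A) A0)).
apply: le_plane_measure => //; last exact: interior_subset.
by apply: open_plane_measurable; exact: open_interior.
Qed.

Lemma bigU_measurable (I : Type) (s : seq I) (B : I -> set point) :
  (forall i, plane_measurable (B i)) ->
  plane_measurable (\big[setU/set0]_(i <- s) B i).
Proof. by move=> mB; apply: bigsetU_measurable => i _; exact: mB. Qed.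

Lemma area_subadd (I : finType) A (B : I -> set point) : bounded_set A ->
  plane_measurable A -> (forall i, plane_measurable (B i)) ->
  (forall i, bounded_set (B i)) ->
  (forall x, A x -> exists i, B i x) -> area A <= \sum_i area (B i).
Proof.
move=> bA mA mB bB AB; rewrite -lee_fin -areaE// -sumEFin.
have sub (s : seq I) : (plane_measure (\big[setU/set0]_(i <- s) B i) <=
    \sum_(i <- s) (area (B i))%:E)%E.
  elim: s => [|i s IH]; first by rewrite !big_nil plane_measureE measure0.
  rewrite !big_cons; apply: le_trans (leeD (lexx _) IH).
  rewrite -areaE//; apply: measureU2; first exact: mB.
  exact: bigU_measurable.
apply: le_trans (sub (index_enum I)); apply: le_plane_measure => //.
  exact: bigU_measurable.
move=> x /AB[i Bx]; rewrite -bigcup_seq; exists i => //=.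
exact: mem_index_enum.
Qed.

(** Pairwise overlaps of measure zero can be neglected, as shown by adding the
    sets one at a time. *)
Lemma area_superadd (I : finType) A (B : I -> set point) : bounded_set A ->
  plane_measurable A -> (forall i, plane_measurable (B i)) ->
  (forall i, B i `<=` A) ->
  (forall i j, i != j -> plane_measure (B i `&` B j) = 0%E) ->
  \sum_i area (B i) <= area A.
Proof.
move=> bA mA mB BA B0; rewrite -lee_fin -areaE// -sumEFin.
have bB i : bounded_set (B i) by exact: bounded_subset (BA i) bA.
have add (s : seq I) : uniq s -> (plane_measure (\big[setU/set0]_(i <- s) B i) =
    \sum_(i <- s) (area (B i))%:E)%E.
  elim: s => [|i s IH] /=; first by rewrite !big_nil plane_measureE measure0.
  move=> /andP[si us]; rewrite !big_cons -(IH us) -areaE//.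
  have mS := bigU_measurable I s B mB.
  set S := \big[setU/set0]_(j <- s) B j in mS *.
  have fi : (plane_measure (B i) < +oo)%E by rewrite areaE// ltry.
  have -> : plane_measure (B i `|` S) =
      (plane_measure (B i) + plane_measure S - plane_measure (B i `&` S))%E.
    by apply: measureUfinl; [exact: mB|exact: mS|exact: fi].
  suff -> : plane_measure (B i `&` S) = 0%E by rewrite sube0.
  apply/eqP; rewrite eq_le measure_ge0 andbT.
  rewrite /S setIC big_distrl /=; elim: s si {us IH mS S fi} => [|j s IH].
    by rewrite big_nil plane_measureE measure0.
  rewrite inE negb_or => /andP[ij si]; rewrite big_cons.
  have mBI k : plane_measurable (B k `&` B i) by exact: measurableI (mB k) (mB i).
  apply: le_trans (measureU2 _ (mBI j) (bigU_measurable I s _ mBI)) _.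
  have E : plane_measure (B j `&` B i) = 0%E by rewrite B0// eq_sym.
  rewrite [X in (X + _ <= _)%E]E add0e; exact: IH.
rewrite -add ?index_enum_uniq//; apply: le_plane_measure => //.
  exact: bigU_measurable.
by rewrite -bigcup_seq => x [i _]; exact: BA.
Qed.

Definition homothety z (t : R) x : point := z + t *: x.

Lemma leb_affine (z t : R) (A : set R) : 0 < t -> measurable (A : set mR) ->
  leb ((fun x : R => (x - z) / t) @^-1` A) = (t%:E * leb A)%E.
Proof.
move=> t0 mA; pose f (x : mR) : mR := (x - z) / t.
have mf : measurable_fun [set: mR] f.
  apply: measurable_realfun.continuous_measurable_fun => x; rewrite /f.
  by apply: cvgM; [apply: cvgB; [exact: cvg_id|exact: cvg_cst]|exact: cvg_cst].
have tV0 : 0 <= t^-1 by rewrite invr_ge0 ltW.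
(* the image measure, normalized, agrees with Lebesgue measure on half-open
   intervals *)
pose m' := mscale (NngNum tV0) (pushforward leb f).
suff E : leb A = m' mf A.
  rewrite E /m' /mscale /= muleA -EFinM divff ?gt_eqF// mul1e.
  by [].
apply: lebesgue_measure_unique => // _ [[a b] _ <-].
rewrite /m' /mscale /pushforward /=.
have E : f @^-1` `]a, b]%classic = `]z + t * a, z + t * b]%classic.
  apply/seteqP; split => x /=; rewrite !in_itv /= /f ltr_pdivlMr// ler_pdivrMr//;
   by move=> /andP[h1 h2]; apply/andP; split; lra.
rewrite [X in _ = (_ * X)%E](_ : _ = leb `]z + t * a, z + t * b]%classic); last first.
  by rewrite -E.
rewrite !lebesgue_measure_itv /= !lte_fin ltrD2l ltr_pM2l//.
case: ifP => _; last by rewrite mule0.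
rewrite -!EFinB -EFinM; congr (_%:E).
by field; rewrite gt_eqF.
Qed.

Lemma homothetyK z (t : R) A : 0 < t ->
  homothety z t @` A = (fun x => t^-1 *: (x - z)) @^-1` A.
Proof.
move=> t0; have tn : t != 0 by rewrite gt_eqF.
apply/seteqP; split => [_ [x Ax <-]|x /= Ax].
  by rewrite /homothety /= addrC addKr scalerA mulVf// scale1r.
by exists (t^-1 *: (x - z)) => //; rewrite /homothety scalerA divff// scale1r addrC subrK.
Qed.

(** By uniqueness of the product measure it suffices to compare both sides on
    products of Borel sets, where the scaling of the line applies in each
    coordinate. *)
Lemma homothety_measure z (t : R) A : 0 < t -> plane_measurable A ->
  plane_measurable (homothety z t @` A) /\
  plane_measure (homothety z t @` A) = ((t ^+ 2)%:E * plane_measure A)%E.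
Proof.
move=> t0 mA; rewrite homothetyK//.
have tn : t != 0 by rewrite gt_eqF.
pose f1 (w : R) (x : mR) : mR := (x - w) / t.
have mf1 w : measurable_fun [set: mR] (f1 w).
  apply: measurable_realfun.continuous_measurable_fun => x; rewrite /f1.
  by apply: cvgM; [apply: cvgB; [exact: cvg_id|exact: cvg_cst]|exact: cvg_cst].
pose f (x : mR * mR) : mR * mR := (f1 z.1 x.1, f1 z.2 x.2).
have mf : measurable_fun [set: mR * mR] f.
  apply: measurable_fun_pair.
    by apply: (measurableT_comp (mf1 z.1)); exact: measurable_fst.
  by apply: (measurableT_comp (mf1 z.2)); exact: measurable_snd.
have fE : (fun x : point => t^-1 *: (x - z)) = f.
  apply/funext => x; rewrite /f /f1 /=.
  by rewrite [LHS]surjective_pairing /= /GRing.scale /= ![t^-1 * _]mulrC.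
rewrite fE; split.
  by rewrite /plane_measurable -[X in measurable X]setTI; exact: mf.
have tV0 : 0 <= (t ^+ 2)^-1 by rewrite invr_ge0 sqr_ge0.
pose m' := mscale (NngNum tV0) (pushforward mu f).
suff E : mu A = m' mf A.
  rewrite !plane_measureE E /m' /mscale /= muleA -EFinM divff ?expf_neq0// mul1e.
  by [].
apply: product_measure_unique => // B C mB mC.
rewrite /m' /mscale /pushforward /=.
have E : mu (f @^-1` (B `*` C)) = (leb (f1 z.1 @^-1` B) * leb (f1 z.2 @^-1` C))%E.
  have -> : f @^-1` (B `*` C) = (f1 z.1 @^-1` B) `*` (f1 z.2 @^-1` C) by [].
  by apply: product_measure1E; rewrite -[X in measurable X]setTI; exact: mf1.
rewrite [X in (_ * X)%E = _](_ : _ = mu (f @^-1` (B `*` C)))// E.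
rewrite !leb_affine// muleACA [LHS]muleA -!EFinM /= -expr2 mulVf ?expf_neq0// mul1e.
by [].
Qed.

Lemma homothety_measurable z (t : R) A : 0 < t -> plane_measurable A ->
  plane_measurable (homothety z t @` A).
Proof. by move=> t0 mA; have [] := homothety_measure z t A t0 mA. Qed.

Lemma area_homothety z (t : R) A : 0 < t -> plane_measurable A ->
  area (homothety z t @` A) = t ^+ 2 * area A.
Proof.
move=> t0 mA; rewrite /area (homothety_measure z t A t0 mA).2.
have [fA|] := boolP (plane_measure A \is a fin_num); first by rewrite fineM.
rewrite ge0_fin_numE ?measure_ge0// -leNgt leye_eq => /eqP ->.
by rewrite gt0_muley ?lte_fin ?exprn_gt0//= mulr0.
Qed.
End Area.

(** * Polygons inside an open convex set *)

Section FiniteHull.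
Context {R : realType}.
Local Notation point := (R * R)%type.
Implicit Types (A C K : set point) (p q u v x y z : point).

(** The convex hull of a point and a convex set, as the image of a compact set
    under a continuous map. *)
Definition cone_over x K : set point :=
  (fun z : R * point => z.1 *: x + (1 - z.1) *: z.2) @` (`[0, 1]%classic `*` K).

Lemma cone_over_compact x K : compact K -> compact (cone_over x K).
Proof.
move=> kK; apply: continuous_compact; last first.
  by apply: compact_setX => //; exact: segment_compact.
apply: continuous_subspaceT => z.
apply: cvgD; apply: cvgZ.
- exact: cvg_fst.
- exact: cvg_cst.
- by apply: cvgB; [exact: cvg_cst|exact: cvg_fst].
- exact: cvg_snd.
Qed.

Lemma cone_over_convex x K : convex K -> convex (cone_over x K).
Proof.
move=> cK _ _ l l0 l1 [[t y] [/= t01 Ky] <-] [[t' y'] [/= t01' Ky'] <-] /=.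
move: t01 t01'; rewrite !in_itv /= => /andP[t0 t1] /andP[t0' t1'].
set T := l * t + (1 - l) * t'.
have a0 : 0 <= l * (1 - t) by rewrite mulr_ge0// subr_ge0.
have b0 : 0 <= (1 - l) * (1 - t') by rewrite mulr_ge0// subr_ge0.
have T1 : 1 - T = l * (1 - t) + (1 - l) * (1 - t') by rewrite /T; ring.
have T0 : 0 <= T by rewrite addr_ge0// mulr_ge0// subr_ge0.
have [E|E] := eqVneq T 1.
  have a00 : l * (1 - t) = 0 by lra.
  have b00 : (1 - l) * (1 - t') = 0 by lra.
  exists (1, y) => /=; first by split => //=; rewrite in_itv /= ler01 lexx.
  rewrite !scalerDr !scalerA a00 b00 !scale0r !addr0 -scalerDl -/T E.
  by rewrite subrr scale0r addr0.
have T1' : T < 1 by rewrite lt_neqAle E /=; lra.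
have Tn : 1 - T != 0 by rewrite subr_eq0 eq_sym.
pose m := l * (1 - t) / (1 - T).
exists (T, m *: y + (1 - m) *: y') => /=.
  split; first by rewrite /= in_itv /= T0 ltW.
  apply: cK => //=; first by rewrite divr_ge0//; lra.
  by rewrite ler_pdivrMr ?mul1r; lra.
have m1 : (1 - T) * m = l * (1 - t) by rewrite /m mulrC divfK.
have m2 : (1 - T) * (1 - m) = (1 - l) * (1 - t') by rewrite mulrBr m1 mulr1 T1; ring.
rewrite !scalerDr !scalerA m1 m2 addrACA -scalerDl; congr (_ *: _ + _).
Qed.

Lemma hull_seq_compact (s : seq point) : compact (convex_hull [set` s]).
Proof.
elim: s => [|x s IH].
  have -> : convex_hull [set` [::]] = set0 :> set point; last exact: compact0.
  by apply/seteqP; split => //; apply: hull_sub => // y.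
have [s0|s0] := eqVneq s [::].
  have -> : convex_hull [set` x :: s] = [set x]; last exact: compact_set1.
  apply/seteqP; split; last first.
    by move=> _ ->; apply: sub_hull; rewrite /= mem_head.
  apply: hull_sub => [y z t t0 t1 -> ->|y]; last by rewrite s0 /= inE => /eqP.
  by rewrite /= -scalerDl addrC subrK scale1r.
have -> : convex_hull [set` x :: s] = cone_over x (convex_hull [set` s]);
  last exact: cone_over_compact.
apply/seteqP; split.
  apply: hull_sub; first by apply: cone_over_convex; exact: hull_convex.
  have [w ws] : exists w, w \in s.
    by case: s s0 {IH} => // w s _; exists w; rewrite mem_head.
  move=> y; rewrite /= inE => /orP[/eqP ->|ys].
    exists (1, w) => /=; last by rewrite scale1r subrr scale0r addr0.
    by split; [rewrite /= in_itv /= ler01 lexx|exact: sub_hull].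
  exists (0, y) => /=; last by rewrite scale0r subr0 scale1r add0r.
  by split; [rewrite /= in_itv /= ler01 lexx|exact: sub_hull].
move=> _ [[t y] [/= + Ky] <-] /=; rewrite in_itv /= => /andP[t0 t1].
apply: hull_convex => //; first by apply: sub_hull; rewrite /= mem_head.
by apply: hull_sub Ky; [exact: hull_convex|move=> z zs; apply: sub_hull; rewrite /= inE (zs : z \in s) orbT].
Qed.

Lemma convex_rectangle C (a b c d : R) x : convex C ->
  C (a, c) -> C (a, d) -> C (b, c) -> C (b, d) -> a < b -> c < d ->
  a <= x.1 <= b -> c <= x.2 <= d -> C x.
Proof.
move=> cC ac ad bc bd ab cd /andP[x1 x2] /andP[y1 y2].
pose s := (x.1 - a) / (b - a); pose t := (x.2 - c) / (d - c).
have ab0 : 0 < b - a by lra.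
have cd0 : 0 < d - c by lra.
have sD : s * (b - a) = x.1 - a by rewrite divfK// gt_eqF.
have tD : t * (d - c) = x.2 - c by rewrite divfK// gt_eqF.
have s0 : 0 <= s by rewrite divr_ge0//; lra.
have s1 : s <= 1 by rewrite ler_pdivrMr//; lra.
have t0 : 0 <= t by rewrite divr_ge0//; lra.
have t1 : t <= 1 by rewrite ler_pdivrMr//; lra.
have -> : x = t *: (s *: (b, d) + (1 - s) *: (a, d)) + (1 - t) *: (s *: (b, c) + (1 - s) *: (a, c)).
  rewrite [LHS]surjective_pairing [RHS]surjective_pairing /= /GRing.scale /=.
  by congr (_, _); lra.
by apply: (cC) => //; apply: (cC).
Qed.

(** The polygons are the hulls of the first points of an enumeration of the
    rational points of [A]. They increase to [A], because every point of [A]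
    lies in a rectangle in [A] with rational corners, and so do their areas.
    *)
Lemma inner_polygon A (e : R) : open A -> bounded_set A -> convex A -> A !=set0 ->
  0 < e -> exists W, [/\ convex_body W, finite_set (extreme W), W `<=` A &
    area A - e < area W].
Proof.
move=> oA bA cA [x0 Ax0] e0.
pose pt (r : rat * rat) : point := (ratr r.1, ratr r.2).
pose q (m : nat) : point := if unpickle m is Some r then
  (if `[< A (pt r) >] then pt r else x0) else x0.
have Aq m : A (q m) by rewrite /q; case: unpickle => // r; case: asboolP.
pose W n := convex_hull [set` [seq q i | i <- iota 0 n]].
have WA n : W n `<=` A by apply: hull_sub => // _ /mapP[i _ ->].
have kW n : compact (W n) by exact: hull_seq_compact.
have mW n : plane_measurable (W n).
  by apply: closed_plane_measurable; exact: plane_compact_closed.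
have ndW : nondecreasing_seq W.
  move=> m n mn; apply/subsetPset; apply: hull_sub; first exact: hull_convex.
  move=> _ /mapP[i + ->]; rewrite mem_iota /= => im.
  apply: sub_hull; apply/mapP; exists i => //; rewrite mem_iota /= add0n.
  exact: leq_trans mn.
have mA := open_plane_measurable A oA.
have UW : \bigcup_n W n = A.
  apply/seteqP; split; first by move=> x [n _]; exact: WA.
  move=> x Ax; have [[[a b] [c d]] [/= /andP[a1 b1] /andP[c1 d1] rA]] := open_rat_box A x oA Ax.
  have ab : ratr a < ratr b :> R by lra.
  have cd : ratr c < ratr d :> R by lra.
  pose N := (pickle (a, c) + pickle (a, d) + pickle (b, c) + pickle (b, d)).+1.
  have inW r : (pickle r < N)%N -> A (pt r) -> W N (pt r).
    move=> rN Ar; apply: sub_hull; apply/mapP; exists (pickle r).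
      by rewrite mem_iota.
    by rewrite /q pickleK asboolT.
  exists N => //; apply: (@convex_rectangle _ (ratr a) (ratr b) (ratr c) (ratr d)) => //;
    rewrite ?a1 ?b1 ?c1 ?d1 ?(ltW a1) ?(ltW b1) ?(ltW c1) ?(ltW d1)//; first exact: hull_convex.
  - apply: (inW (a, c)); first by rewrite /N; lia.
    by apply: rA => /=; rewrite lexx ltW.
  - apply: (inW (a, d)); first by rewrite /N; lia.
    by apply: rA => /=; rewrite lexx ltW.
  - apply: (inW (b, c)); first by rewrite /N; lia.
    by apply: rA => /=; rewrite lexx ltW.
  - apply: (inW (b, d)); first by rewrite /N; lia.
    by apply: rA => /=; rewrite lexx ltW.
have A0 : 0 < area A.
  by apply: area_gt0 => //; exists x0; exact: oA.
have := @nondecreasing_cvg_mu _ _ _ (product_measure1 (@lebesgue_measure R) (@lebesgue_measure R)) W mW.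
rewrite UW => /(_ mA ndW) cvgW.
pose e' := Num.min e (area A / 2).
(* [e'] also leaves room for a positive area, which forces an interior *)
have [N WN] : exists N, area A - e' < area (W N).
  apply: contrapT => small.
  have le_n n : (plane_measure (W n) <= (area A - e')%:E)%E.
    rewrite areaE//; last by apply: bounded_subset bA; exact: WA.
    by rewrite lee_fin leNgt; apply/negP => ?; apply: small; exists n.
  have cvg' : (fun n => plane_measure (W n)) @ \oo --> plane_measure A by exact: cvgW.
  have : (limn (fun n => plane_measure (W n)) <= (area A - e')%:E)%E.
    apply: lime_le; first by apply/cvg_ex; exists (plane_measure A).
    exact: nearW.
  rewrite (cvg_lim _ cvg')// areaE// lee_fin.
  have : 0 < e' by rewrite lt_min e0 divr_gt0.
  lra.
exists (W N).
have WN0 : (W N)° !=set0.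
  apply: contrapT => flat.
  have := flat_measure0 _ (hull_convex _) (mW N) flat.
  move: WN; rewrite [area (W N)]/area => + E; rewrite E /=.
  have : e' <= area A / 2 by rewrite ge_min lexx orbT.
  lra.
split => //.
- by split => //; apply/convexP; exact: hull_convex.
- apply: (@sub_finite_set _ _ [set` [seq q i | i <- iota 0 N]]).
    exact: extreme_hull.
  exact: finite_seq.
- apply: le_lt_trans WN; by rewrite lerD2l lerN2 ge_min lexx.
Qed.
End FiniteHull.

(** * Cells of a partition cut by a polygon *)

Section Cells.
Context {R : realType}.
Local Notation point := (R * R)%type.
Implicit Types (A C K W : set point) (p q u v x y z : point).

Lemma compact_plane_measurable K : compact K -> plane_measurable K.
Proof. by move=> kK; apply: closed_plane_measurable; exact: plane_compact_closed. Qed.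

Lemma extreme_enum K : finite_set (extreme K) ->
  exists s : seq point, uniq s /\ forall x, x \in s <-> extreme K x.
Proof.
move=> /finite_seqP[s sE]; exists (undup s); split; first exact: undup_uniq.
by move=> x; rewrite mem_undup sE.
Qed.

Lemma convex_bodyI K W : convex_body K -> convex_body W -> (K `&` W)° !=set0 ->
  convex_body (K `&` W).
Proof.
move=> bK bW; split => //.
  by apply/convexP; apply: convexI; exact: body_convex.
by case: bK bW => _ kK _ [_ kW _]; apply: compact_closedI => //; exact: plane_compact_closed.
Qed.

Lemma interior_dense K x A : convex K -> K° !=set0 -> K x -> nbhs x A ->
  exists2 y, K° y & A y.
Proof.
move=> cK K0 Kx Ax; have [y Ay Ky] := interior_meet A K x cK K0 Ax Kx.
by exists y => //; exact: interior_subset Ay.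
Qed.

(** Cutting the partition by the polygon [W] yields polygons that tile [W].
    Cells for which the intersection has empty interior are null sets; by
    density the other ones still cover [W], so that [vertex_count] applies to
    them. The null cells get the dummy number of sides [3], which keeps the
    average number of sides below [6] up to the constant [N], depending only
    on [W]. *)
Lemma partition_cells Omega W : bounded_set Omega -> convex_body W ->
    finite_set (extreme W) -> W `<=` Omega ->
  exists N : nat, forall k (P : 'I_k -> set point), convex_partition Omega P ->
  exists n : 'I_k -> nat, [/\ forall i, (3 <= n i)%N,
    (\sum_i n i <= 6 * k + N)%N,
    forall i, (P i `&` W)° !=set0 -> is_ngon (n i) (P i `&` W),
    forall i, ~ ((P i `&` W)° !=set0) -> area (P i `&` W) = 0 &
    area W <= \sum_i area (P i `&` W)].
Proof.
move=> bO bW fW WO; have [EW [uEW EWE]] := extreme_enum W fW.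
exists (2 * size EW)%N => k P [polyP covP disP _].
have bP i : convex_body (P i) by have /polygonP[] := polyP i.
have cP i : convex (P i) by exact: body_convex.
have kP i : compact (P i) by case: (bP i).
have cW : convex W by exact: body_convex.
have kW : compact W by case: (bW).
have W0 : W° !=set0 by case: (bW).
have cPW i : convex (P i `&` W) by exact: convexI.
have kPW i : compact (P i `&` W) by apply: compact_closedI => //; exact: plane_compact_closed.
have mPW i := compact_plane_measurable _ (kPW i).
have bPW i := compact_bounded (kPW i).
have ex_enum i : exists s : seq point, uniq s /\
    forall x, x \in s <-> extreme (P i `&` W) x.
  apply: extreme_enum; apply: finite_extremeI => //; first by case: (bP i).
  by have /polygonP[] := polyP i.
have [E EE] := boolp.choice ex_enum.
pose J : pred 'I_k := fun i => `[< (P i `&` W)° !=set0 >].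
exists (fun i => if J i then size (E i) else 3%N).
have J_ngon i : J i -> (3 <= size (E i))%N /\ is_ngon (size (E i)) (P i `&` W).
  move=> /asboolP Ji; have [uE Ee] := EE i; apply: extreme_ngon => //.
  exact: convex_bodyI.
have cov x : W x -> exists i, P i x.
  move=> Wx; have : closure Omega x by apply: subset_closure; exact: WO.
  by rewrite -covP => -[i _ [Pix _]]; exists i.
have flat i : ~~ J i -> area (P i `&` W) = 0.
  move=> /asboolPn h; rewrite /area (flat_measure0 _ (cPW i) (mPW i) h).
  by [].
have thick x : W x -> exists2 i, J i & P i x.
  move=> Wx; apply: contrapT => none.
  pose U := [set y | forall i, J i -> ~ P i y].
  have Ux : nbhs x U.
    suff : \forall y \near nbhs x, forall i, J i -> ~ P i y by [].
    apply: filter_forall => i; have [Ji|nJi] := boolP (J i); last by apply: filterE.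
    have : nbhs x (~` P i).
      apply: open_nbhs_nbhs; split; first by apply: closed_openC; exact: plane_compact_closed.
      by move=> Pix; apply: none; exists i.
    by apply: filterS => y Py _.
  have [y Wy Uy] : exists2 y, W° y & U° y.
    apply: (interior_dense W x) => //.
    suff : (U°)° x by [].
    by move: Ux; apply: (@open_interior _ U).
  (* a nonempty open set covered by null cells only *)
  pose O := W° `&` U°.
  have oO : open O by apply: openI; exact: open_interior.
  have mO := open_plane_measurable _ oO.
  have bO' : bounded_set O.
    apply: (bounded_subset _ W); last exact: compact_bounded.
    by move=> z [Wz _]; exact: interior_subset Wz.
  have O0 : 0 < area O by apply: area_gt0 => //; exists y; apply: oO; split.
  pose B i := if J i then set0 else P i `&` W.
  have : area O <= \sum_i area (B i).
    apply: area_subadd => //.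
    - by move=> i; rewrite /B; case: ifP => _ //; exact: measurable0.
    - by move=> i; rewrite /B; case: ifP => _ //; apply: (bounded_subset _ W) => //; exact: compact_bounded.
    - move=> z [Wz Uz]; have [i Piz] := cov z (interior_subset Wz).
      exists i; rewrite /B; case: ifP => Ji; last by split => //; exact: interior_subset.
      by have := interior_subset Uz _ Ji.
  rewrite big1 => [|i _]; first by rewrite leNgt O0.
  by rewrite /B; case: ifPn => [_|/flat //]; rewrite /area plane_measureE measure0.
split.
- by move=> i; case: ifP => // /J_ngon[].
- rewrite big_if /= sum_nat_const.
  have Jin (j : 'I_#|J|) : J (enum_val j) by have := enum_valP j; rewrite unfold_in.
  have := @vertex_count R _ (fun j : 'I_#|J| => P (enum_val j) `&` W) W
    (fun j => E (enum_val j)) EW.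
  rewrite card_ord => count.
  have {}count : (\sum_(i | J i) size (E i) <= 6 * #|J| + 2 * size EW)%N.
    have -> : (\sum_(i | J i) size (E i) = \sum_(i in J) size (E i))%N by apply: eq_bigl.
    rewrite big_enum_val; apply: count => //.
    - by move=> j; exact/asboolP/Jin.
    - move=> i j x ix jx; apply/enum_val_inj/eqP; apply: contraT => /disP P0.
      have oI : open ((P (enum_val i) `&` W)° `&` (P (enum_val j) `&` W)°).
        by apply: openI; exact: open_interior.
      have := open_measure_gt0 _ oI; rewrite ltNge => /(_ _)/negP; case; first by exists x.
      rewrite -P0; apply: le_plane_measure; first exact: open_plane_measurable.
        by apply: compact_plane_measurable; apply: compact_closedI => //; exact: plane_compact_closed.
      by move=> y [/interior_subset[? _] /interior_subset[? _]].
    - move=> x Wx; have [i Ji Pi] := thick x Wx.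
      by exists (enum_rank_in Ji i); split => //; rewrite enum_rankK_in.
    - by move=> j; case: (EE (enum_val j)).
    - by move=> j; case: (EE (enum_val j)).
    - by move=> x /EWE.
  have := cardC J; rewrite card_ord => JC.
  have E3 : #|[predC J]| = #|(fun i => ~~ J i)| by apply: eq_card.
  rewrite E3 in JC; apply: leq_trans (leq_add count (leqnn _)) _.
  by rewrite -[X in (_ <= 6 * X + _)%N]JC mulnDr addnAC leq_add2r leq_add2l mulnC leq_mul2r orbT.
- by move=> i /asboolP Ji; rewrite ifT//; have [] := J_ngon i Ji.
- by move=> i h; apply: flat; apply/asboolPn.
- apply: area_subadd => //; [exact: compact_bounded|exact: compact_plane_measurable|].
  by move=> x Wx; have [i Pi] := cov x Wx; exists i.
Qed.
End Cells.

(** * Regular hexagons *)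

Section Hexagons.
Context {R : realType}.
Local Notation point := (R * R)%type.
Implicit Types (A C H K V W : set point) (p q u v w x y z : point).

Lemma homothety_mix z (t l : R) x y :
  homothety z t (l *: x + (1 - l) *: y) = l *: homothety z t x + (1 - l) *: homothety z t y.
Proof.
rewrite /homothety [LHS]surjective_pairing [RHS]surjective_pairing /= /GRing.scale /=.
by congr (_, _); ring.
Qed.

Lemma hull_homothety z (t : R) V :
  convex_hull (homothety z t @` V) = homothety z t @` convex_hull V.
Proof.
apply/seteqP; split.
  apply: hull_sub.
    move=> _ _ l l0 l1 [x hx <-] [y hy <-]; rewrite -homothety_mix.
    by exists (l *: x + (1 - l) *: y) => //; apply: hull_convex.
  by move=> _ [x Vx <-]; exists x => //; apply: sub_hull.
move=> _ [x hx <-]; have := hull_sub V (homothety z t @^-1` convex_hull (homothety z t @` V)).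
move=> h; apply: (h _ _ x hx).
  move=> a b l l0 l1 /= ha hb; rewrite homothety_mix; exact: hull_convex.
by move=> v Vv; apply: sub_hull; exists v.
Qed.

Lemma homothety_homothety z w (t s : R) A :
  homothety z t @` (homothety w s @` A) = homothety (z + t *: w) (t * s) @` A.
Proof.
rewrite image_comp; apply: eq_imagel => x _ /=.
by rewrite /homothety scalerDr addrA scalerA.
Qed.

Lemma homothety_id A : homothety 0 1 @` A = A.
Proof.
rewrite -[RHS]image_id; apply: eq_imagel => x _ /=.
by rewrite /homothety add0r scale1r.
Qed.

Lemma scale_homothety (t : R) A : [set t *: x | x in A] = homothety 0 t @` A.
Proof. by apply: eq_imagel => x _; rewrite /homothety add0r. Qed.

Lemma regular_hexagon_homothety z (t : R) H : 0 < t -> regular_hexagon H ->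
  regular_hexagon (homothety z t @` H).
Proof.
move=> t0 [c [r [theta [r0 ->]]]].
exists (z + t *: c), (t * r), theta; split; first exact: mulr_gt0.
rewrite -hull_homothety image_comp; congr (convex_hull _).
apply: eq_imagel => i _ /=.
by rewrite /homothety scalerDr addrA scalerA.
Qed.

Lemma hull_finite_compact V : finite_set V -> compact (convex_hull V).
Proof. by move=> /finite_seqP[s ->]; exact: hull_seq_compact. Qed.

Lemma regular_hexagon_compact H : regular_hexagon H -> compact H.
Proof.
move=> [c [r [theta [_ ->]]]]; apply: hull_finite_compact.
by apply: finite_image; exact: finite_finset.
Qed.

Lemma regular_hexagon_convex H : regular_hexagon H -> convex H.
Proof. by move=> [c [r [theta [_ ->]]]]; exact: hull_convex. Qed.

Lemma regular_hexagon_body H : regular_hexagon H -> 0 < area H -> convex_body H.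
Proof.
move=> rH A0; split; first by apply/convexP; exact: regular_hexagon_convex.
  exact: regular_hexagon_compact.
apply: contrapT => flat; move: A0; rewrite /area flat_measure0 ?ltxx//.
  exact: regular_hexagon_convex.
by apply: compact_plane_measurable; exact: regular_hexagon_compact.
Qed.

Lemma regular_hexagon_extreme H : regular_hexagon H -> finite_set (extreme H).
Proof.
move=> [c [r [theta [_ ->]]]]; apply: sub_finite_set.
  exact: extreme_hull.
by apply: finite_image; exact: finite_finset.
Qed.

Variables (F : set point -> R) (alpha g6 : R).
Hypothesis F_mono : forall K1 K2, convex_body K1 -> convex_body K2 ->
  K1 `<=` K2 -> F K1 <= F K2.
Hypothesis F_homog : forall (t : R) K, 0 < t -> convex_body K ->
  F [set t *: x | x in K] = t `^ alpha * F K.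
Hypothesis F_unit : forall H, unit_hexagon H -> g6 = F H.

(** [F] is not assumed to be invariant under translations. On hexagons it
    nevertheless depends only on the area: a regular hexagon is a dilation
    centred at the origin of a unit one, and on unit hexagons [F] is constant.
    *)
Lemma F_hexagon H : regular_hexagon H -> 0 < area H ->
  F H = area H `^ (alpha / 2) * g6.
Proof.
move=> rH A0; set a := area H; have sa : 0 < Num.sqrt a by rewrite sqrtr_gt0.
pose K := homothety 0 (Num.sqrt a)^-1 @` H.
have mH := compact_plane_measurable _ (regular_hexagon_compact _ rH).
have sV : 0 < (Num.sqrt a)^-1 by rewrite invr_gt0.
have rK : regular_hexagon K by exact: regular_hexagon_homothety.
have aK : area K = 1.
  by rewrite area_homothety// exprVn sqr_sqrtr ?ltW// mulVf// gt_eqF.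
have uK : unit_hexagon K by [].
have bK : convex_body K by apply: regular_hexagon_body => //; rewrite aK.
have -> : H = [set Num.sqrt a *: x | x in K].
  rewrite scale_homothety homothety_homothety scaler0 addr0 divff ?gt_eqF//.
  by rewrite homothety_id.
rewrite F_homog// -(F_unit _ uK); congr (_ * _).
by rewrite -powR12_sqrt ?ltW// -powRrM mulrC.
Qed.

(** A convex body contains a small regular hexagon. *)
Lemma F_gt0 H K : unit_hexagon H -> 0 < g6 -> convex_body K -> 0 < F K.
Proof.
move=> [rH aH] g0 bK; have [_ _ [p Kp]] := bK.
have kH := regular_hexagon_compact _ rH.
have [M M0 HM] := bounded_box _ (compact_bounded kH).
have /interiorP[r r0 rK] := Kp.
pose t := r / M; have t0 : 0 < t by exact: divr_gt0.
pose L := homothety p t @` H.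
have rL : regular_hexagon L by exact: regular_hexagon_homothety.
have aL : area L = t ^+ 2.
  by rewrite area_homothety ?aH ?mulr1//; exact: compact_plane_measurable.
have aL0 : 0 < area L by rewrite aL exprn_gt0.
have tM : t * M = r by rewrite /t divfK// gt_eqF.
have small (s : R) : - M < s < M -> `|t * s| < r.
  by move=> /andP[s1 s2]; rewrite normrM gtr0_norm// -tM ltr_pM2l// ltr_norml s1.
have LK : L `<=` K.
  move=> _ [x Hx <-]; have [] := HM _ Hx; rewrite /= !in_itv /= => x1 x2.
  by apply: rK; rewrite /homothety /= addrC addKr; exact: small.
apply: lt_le_trans (F_mono _ _ (regular_hexagon_body _ rL aL0) bK LK).
by rewrite F_hexagon// mulr_gt0// powR_gt0.
Qed.
End Hexagons.

(** * The lower bound *)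

Section LowerBound.
Context {R : realType}.
Local Notation point := (R * R)%type.
Implicit Types (A C H K V W : set point) (p q u v w x y z : point).

Lemma closure_boxP A p : closure A p <->
  forall r : R, 0 < r -> exists x, [/\ A x, `|x.1 - p.1| < r & `|x.2 - p.2| < r].
Proof.
split=> [clA r r0|h B].
  have /clA[x [Ax [x1 x2]]] : nbhs p (ball p r) by exact: nbhsx_ballx.
  by exists x; split => //; rewrite distrC; move: x1 x2; rewrite -!ball_normE.
move=> /nbhs_ballP[r /= r0 rB]; have [x [Ax x1 x2]] := h r r0.
exists x; split => //; apply: rB; split; rewrite -ball_normE /= distrC//.
Qed.

Lemma mix_norm_lt (t d e r : R) : 0 <= t -> t <= 1 -> `|d| < r -> `|e| < r ->
  `|t * d + (1 - t) * e| < r.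
Proof.
move=> t0 t1 dr er; have t1' : 0 <= 1 - t by rewrite subr_ge0.
pose m := Num.max `|d| `|e|.
have mr : m < r by rewrite gt_max dr.
apply: le_lt_trans mr; apply: le_trans (ler_normD _ _) _.
rewrite !normrM (ger0_norm t0) (ger0_norm t1').
have -> : m = t * m + (1 - t) * m by ring.
by apply: lerD; apply: ler_wpM2l => //; rewrite le_max lexx ?orbT.
Qed.

Lemma closure_convex A : convex A -> convex (closure A).
Proof.
move=> cA x y t t0 t1 /closure_boxP cx /closure_boxP cy; apply/closure_boxP => r r0.
have [a [Aa a1 a2]] := cx r r0; have [b [Ab b1 b2]] := cy r r0.
exists (t *: a + (1 - t) *: b); split; first exact: cA.
  have := mix_norm_lt t _ _ r t0 t1 a1 b1.
  by congr (`|_| < _); rewrite /= /GRing.scale /=; ring.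
have := mix_norm_lt t _ _ r t0 t1 a2 b2.
by congr (`|_| < _); rewrite /= /GRing.scale /=; ring.
Qed.

Lemma closure_compact A : bounded_set A -> compact (closure A).
Proof.
move=> /bounded_box[M M0 AM].
pose B : set point := `[- M, M]%classic `*` `[- M, M]%classic.
have kB : compact B by apply: compact_setX; exact: segment_compact.
apply: (@subclosed_compact _ _ B) => //; first exact: closed_closure.
rewrite [B](closure_id _).1; last exact: plane_compact_closed.
apply: closureS => x /AM[]; rewrite /= !in_itv /= => /andP[h1 h2] /andP[h3 h4].
by split; rewrite /= in_itv /= !ltW.
Qed.

Lemma closure_body A : convex A -> bounded_set A -> A° !=set0 ->
  convex_body (closure A).
Proof.
move=> cA bA [x Ax]; split; first by apply/convexP; exact: closure_convex.
  exact: closure_compact.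
by exists x; move: Ax; apply: interiorS; exact: subset_closure.
Qed.

Variables (Omega : set point) (F : set point -> R) (alpha : R) (gamma : nat -> R).
Hypothesis bO : bounded_set Omega.
Hypothesis oO : open Omega.
Hypothesis cO : convex Omega.
Hypothesis O0 : Omega !=set0.
Hypothesis alpha_gt0 : 0 < alpha.
Hypothesis F_mono : forall K1 K2, convex_body K1 -> convex_body K2 ->
  K1 `<=` K2 -> F K1 <= F K2.
Hypothesis F_homog : forall (t : R) K, 0 < t -> convex_body K ->
  F [set t *: x | x in K] = t `^ alpha * F K.
Hypothesis gamma_min : forall n, (3 <= n)%N ->
  is_min [set F P * area P `^ (- (alpha / 2)) | P in @is_ngon R n] (gamma n).
Hypothesis gamma_6 : forall H, unit_hexagon H -> gamma 6%N = F H.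

Lemma area_Omega_gt0 : 0 < area Omega.
Proof.
have [x Ox] := O0.
by apply: area_gt0 => //; [exact: open_plane_measurable|exists x; exact: oO].
Qed.

Lemma gamma_gt0 H n : unit_hexagon H -> 0 < gamma 6%N -> (3 <= n)%N -> 0 < gamma n.
Proof.
move=> uH g0 n3; have [[K nK <-] _] := gamma_min n n3.
have bK : convex_body K by case: nK.
have FK := F_gt0 F alpha (gamma 6%N) F_mono F_homog gamma_6 H K uH g0 bK.
rewrite mulr_gt0// powR_gt0//; case: bK => _ kK K0.
by apply: area_gt0 => //; [exact: compact_bounded|exact: compact_plane_measurable].
Qed.

(** The exponents [2 / alpha] and [alpha / 2] convert between values of [F]
    and areas. *)
Lemma powR_half_inv (a : R) : 0 <= a -> (a `^ (2 / alpha)) `^ (alpha / 2) = a.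
Proof.
move=> a0; rewrite -powRrM; have -> : 2 / alpha * (alpha / 2) = 1.
  by field; rewrite gt_eqF.
exact: powRr1.
Qed.

(** The definition of [gamma n], read as an upper bound on the area of an
    [n]-gon on which [F] is at most [M]. *)
Lemma ngon_area_le n K (M : R) : (3 <= n)%N -> 0 < gamma n -> is_ngon n K ->
  F K <= M -> area K <= M `^ (2 / alpha) * gamma n `^ (- (2 / alpha)).
Proof.
move=> n3 g0 nK FM; have [_ gmin] := gamma_min n n3.
have [_ kK K0] : convex_body K by case: nK.
have A0 : 0 < area K.
  by apply: area_gt0 => //; [exact: compact_bounded|exact: compact_plane_measurable].
have := gmin _ (ex_intro2 _ _ K nK erefl); rewrite powRN ler_pdivlMr ?powR_gt0// => h.
have gM : gamma n * area K `^ (alpha / 2) <= M by exact: le_trans h FM.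
have q0 : 0 <= 2 / alpha by rewrite divr_ge0// ltW.
have gA : 0 <= gamma n * area K `^ (alpha / 2) by rewrite mulr_ge0 ?powR_ge0 ?ltW.
have := @ge0_ler_powR _ _ q0 _ _ gA (le_trans gA gM) gM.
rewrite powRM ?powR_ge0 ?(ltW g0)// -powRrM.
have -> : alpha / 2 * (2 / alpha) = 1 by field; rewrite gt_eqF.
rewrite powRr1 ?(ltW A0)// powRN => h'.
by rewrite ler_pdivlMr ?powR_gt0// mulrC.
Qed.

(** Let [M] bound [F] on all cells, and let [W] be a polygon in [Omega] of
    almost full area. Monotonicity bounds [F] by [M] on the cells cut by [W],
    so [ngon_area_le] bounds their areas. Summing over the cells, the
    assumption on averages, applicable because the average number of sides is
    at most [6 + delta] for large [k], yields [area W <= M `^ (2 / alpha) * k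
    * g (6 + delta) `^ (- (2 / alpha))], which is solved for [M]. Continuity
    of [g] at [6] makes [g (6 + delta)] close to [gamma 6]. *)
Lemma lower_bound H (g : R -> R) (k0 : nat) (delta0 eps : R) :
  unit_hexagon H -> 0 < gamma 6%N ->
  (forall n, (3 <= n)%N -> g n%:R = gamma n) ->
  {for 6, continuous g} -> 0 < delta0 ->
  (forall (k : nat) (delta : R) (n : 'I_k -> nat),
     (k0 <= k)%N -> 0 < delta -> delta <= delta0 ->
     (forall i, (3 <= n i)%N) ->
     k%:R^-1 * (\sum_(i < k) (n i)%:R) <= 6 + delta ->
     k%:R^-1 * (\sum_(i < k) g (n i)%:R `^ (- (2 / alpha)))
       <= g (6 + delta) `^ (- (2 / alpha))) ->
  0 < eps -> eps < gamma 6%N ->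
  exists k1 : nat, forall (k : nat) (P : 'I_k -> set point) (M : R),
    (k1 <= k)%N -> convex_partition Omega P -> 0 <= M ->
    (forall i, F (closure (P i `&` Omega)) <= M) ->
    gamma 6%N - eps <= k%:R `^ (alpha / 2) / area Omega `^ (alpha / 2) * M.
Proof.
move=> uH g60 gE gcont d00 gconc eps0 epsg.
set L := gamma 6%N - eps; have L0 : 0 < L by rewrite subr_gt0.
have a20 : 0 < alpha / 2 by rewrite divr_gt0.
have q0 : 0 < 2 / alpha by rewrite divr_gt0.
have AO := area_Omega_gt0.
have [delta [dl0 dl1 Lc]] : exists delta : R, [/\ 0 < delta, delta <= delta0 & L < g (6 + delta)].
  have g6 : g 6 = gamma 6%N by rewrite -gE.
  have /gcont : nbhs (g 6) [set y | L < y].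
    by apply: open_nbhs_nbhs; split; [exact: open_gt|rewrite /= g6 /L; lra].
  move=> /nbhs_ballP[r /= r0 rg].
  exists (Num.min delta0 (r / 2)); split.
  - by rewrite lt_min d00 divr_gt0.
  - by rewrite ge_min lexx.
  - apply: rg; rewrite -ball_normE /= opprD addrA subrr sub0r normrN.
    rewrite gtr0_norm ?lt_min ?d00 ?divr_gt0//.
    by rewrite gt_min; apply/orP; right; lra.
set c := g (6 + delta) in Lc; have c0 : 0 < c by exact: lt_trans Lc.
(* the fraction of the area of [Omega] that [W] must exceed so that [rho `^
   (alpha / 2) * c = L] *)
pose rho := (L / c) `^ (2 / alpha).
have Lc0 : 0 < L / c by exact: divr_gt0.
have rho1 : rho < 1.
  have -> : 1 = 1 `^ (2 / alpha) :> R by rewrite powR1.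
  apply: gt0_ltr_powR => //; rewrite ?nnegrE ?ltW//.
  by rewrite ltr_pdivrMr// mul1r.
have [W [bW fW WO areaW]] := inner_polygon Omega ((1 - rho) * area Omega) oO bO cO O0
  (mulr_gt0 (etrans (subr_gt0 _ _) rho1) AO).
have {}areaW : rho * area Omega < area W by move: areaW; rewrite mulrBl mul1r; lra.
have [N cells] := partition_cells Omega W bO bW fW WO.
have [k2 k2N] : exists k2 : nat, forall k, (k2 <= k)%N -> N%:R <= delta * k%:R.
  exists (Num.bound (N%:R / delta)) => k hk.
  rewrite mulrC -ler_pdivrMr//; apply: (le_trans (ltW (archi_boundP _))).
    by rewrite divr_ge0// ltW.
  by rewrite ler_nat.
(* [k2] makes the contribution of [N] to the average at most [delta] *)
exists (maxn 1 (maxn k0 k2)) => k P M; rewrite !geq_max => /and3P[k1 kk0 kk2] parP M0 FM.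
have [n [n3 nsum ngonP flatP covP]] := cells k P parP.
have kp : 0 < k%:R :> R by rewrite ltr0n.
have := gconc k delta n kk0 dl0 dl1 n3.
have avg : k%:R^-1 * (\sum_(i < k) (n i)%:R) <= 6 + delta.
  rewrite mulrC ler_pdivrMr// mulrDl.
  apply: le_trans (lerD (lexx _) (k2N _ kk2)).
  by rewrite -natr_sum -natrM -natrD ler_nat.
move=> /(_ avg); rewrite -/c mulrC ler_pdivrMr// => gsum.
have cell i : area (P i `&` W) <= M `^ (2 / alpha) * g (n i)%:R `^ (- (2 / alpha)).
  have [thick|flat] := pselect ((P i `&` W)° !=set0); last first.
    by rewrite flatP// mulr_ge0 ?powR_ge0.
  rewrite gE//; apply: ngon_area_le => //; first exact: (gamma_gt0 H).
    exact: ngonP.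
  have [polyP _ _ intP] := parP.
  have bP : convex_body (P i) by have /polygonP[] := polyP i.
  apply: le_trans (FM i); apply: F_mono.
  - exact: convex_bodyI.
  - apply: closure_body; last exact: intP.
      by apply: convexI => //; exact: body_convex.
    by apply: bounded_subset bO => x [].
  - by move=> x [Px Wx]; apply: subset_closure; split => //; exact: WO.
have areaM : rho * area Omega <= M `^ (2 / alpha) * (c `^ (- (2 / alpha)) * k%:R).
  apply: (le_trans (ltW areaW)); apply: (le_trans covP).
  apply: (@le_trans _ _ (\sum_i M `^ (2 / alpha) * g (n i)%:R `^ (- (2 / alpha)))).
    by apply: ler_sum => i _; exact: cell.
  by rewrite -mulr_sumr ler_wpM2l ?powR_ge0.
have rA : 0 <= rho * area Omega by rewrite mulr_ge0 ?powR_ge0 ?ltW.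
have := @ge0_ler_powR _ _ (ltW a20) _ _ rA (le_trans rA areaM) areaM.
rewrite !powRM ?powR_ge0 ?mulr_ge0 ?powR_ge0 ?ler0n ?(ltW AO)//.
rewrite /rho powR_half_inv ?(ltW Lc0)// powR_half_inv// powRN.
have -> : (c `^ (2 / alpha))^-1 `^ (alpha / 2) = c^-1.
  rewrite -[(_ `^ _)^-1]powR_inv1 ?powR_ge0// -powRAC powR_half_inv ?powR_inv1 ?powR_ge0 ?(ltW c0)//.
have AOp : 0 < area Omega `^ (alpha / 2) by exact: powR_gt0.
move=> h; rewrite mulrAC ler_pdivlMr//.
have : L / c * area Omega `^ (alpha / 2) * c <= M * (c^-1 * k%:R `^ (alpha / 2)) * c.
  by rewrite ler_pM2r.
have -> : L / c * area Omega `^ (alpha / 2) * c = L * area Omega `^ (alpha / 2).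
  by field; rewrite gt_eqF.
suff -> : M * (c^-1 * k%:R `^ (alpha / 2)) * c = k%:R `^ (alpha / 2) * M by [].
by field; rewrite gt_eqF.
Qed.
End LowerBound.

(** * The standard hexagon *)

Section HexagonTiling.
Context {R : realType}.
Local Notation point := (R * R)%type.
Implicit Types (A C H K V W : set point) (p q u v w x y : point).

Definition hex_angle : R := pi / 3.
Definition hex_height : R := sin hex_angle.
Local Notation th := hex_angle.
Local Notation s3 := hex_height.

Lemma sin_pi3_gt0 : 0 < s3.
Proof. by apply: sin_gt0_pi; have := @pi_gt0 R; rewrite /hex_angle; lra. Qed.

(** With [3 * th = pi], the addition formula for [sin (3 * th) = 0] gives [4 *
    cos th ^+ 2 = 1]. *)
Lemma cos_pi3 : cos th = 1 / 2.
Proof.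
have c0 : 0 < cos th by apply: cos_gt0_pihalf; have := @pi_gt0 R; rewrite /hex_angle; lra.
have E : th + (th + th) = pi by rewrite /hex_angle; lra.
have := @sinpi R; rewrite -E !sinD cosD -/s3; set c := cos th.
have := cos2Dsin2 th; rewrite -/s3 -/c => cs h.
have s0 := sin_pi3_gt0.
have h2 : s3 * (4 * c ^+ 2 - 1) = 0.
  have -> : s3 * (4 * c ^+ 2 - 1) =
    s3 * (c * c - s3 * s3) + c * (s3 * c + c * s3) + s3 * (c ^+ 2 + s3 ^+ 2 - 1) by ring.
  by rewrite h cs; ring.
have : (2 * c - 1) * (2 * c + 1) = 0.
  have /eqP := h2; rewrite mulf_eq0 gt_eqF//= => /eqP <-; ring.
move=> /eqP; rewrite mulf_eq0 => /orP[] /eqP; rewrite /c; lra.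
Qed.

Definition hex_vertex (i : nat) : point :=
  match i with
  | 0 => (1, 0) | 1 => (1/2, s3) | 2 => (-(1/2), s3)
  | 3 => (-1, 0) | 4 => (-(1/2), - s3) | _ => (1/2, - s3)
  end.

Lemma hex_vertexE (i : 'I_6) :
  (cos (0 + i%:R * (2 * pi / 6)), sin (0 + i%:R * (2 * pi / 6))) = hex_vertex i.
Proof.
have -> : 2 * pi / 6 = th by rewrite /hex_angle; lra.
rewrite add0r; have thpi : th + th = - th + pi by rewrite /hex_angle; lra.
case: i => -[|[|[|[|[|[|]]]]]] //= _.
- by rewrite ![_ * th]mul0r cos0 sin0.
- by rewrite ![_ * th]mul1r cos_pi3.
- have -> : 2 * th = - th + pi by rewrite -thpi; ring.
  by rewrite cosDpi sinDpi cosN sinN cos_pi3 opprK.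
- have -> : 3 * th = pi by rewrite /hex_angle; lra.
  by rewrite cospi sinpi.
- have -> : 4 * th = th + pi by rewrite /hex_angle; lra.
  by rewrite cosDpi sinDpi cos_pi3.
- have -> : 5 * th = - th + pi + pi by rewrite -thpi /hex_angle; lra.
  by rewrite !cosDpi !sinDpi cosN sinN cos_pi3 !opprK.
Qed.

Definition std_hexagon : set point := convex_hull (range (fun i : 'I_6 =>
  0 + 1 *: (cos (0 + i%:R * (2 * pi / 6)), sin (0 + i%:R * (2 * pi / 6))))).

Lemma std_hexagon_regular : regular_hexagon std_hexagon.
Proof. by exists 0, 1, 0. Qed.

(** The functionals [dot hex_dual1] and [dot hex_dual2] are the coordinates in
    the basis formed by the first two vertices of the hexagon. In these
    coordinates the hexagon is cut out by [|a| <= 1], [|b| <= 1], [|a + b| <=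
    1]. *)
Definition hex_dual1 : point := (1, - (2 * s3)^-1).
Definition hex_dual2 : point := (0, s3^-1).
Local Notation u1 := hex_dual1.
Local Notation u2 := hex_dual2.

(** The vertices satisfy the inequalities, and conversely the six triangles
    spanned by the centre and two neighbouring vertices cover the set that the
    inequalities define. *)
Lemma std_hexagonP x : std_hexagon x <->
  [/\ `|dot u1 x| <= 1, `|dot u2 x| <= 1 & `|dot u1 x + dot u2 x| <= 1].
Proof.
have s0 := sin_pi3_gt0; have sn : s3 != 0 by rewrite gt_eqF.
pose S : set point := [set x | [/\ `|dot u1 x| <= 1, `|dot u2 x| <= 1 & `|dot u1 x + dot u2 x| <= 1]].
have vE (i : 'I_6) : 0 + 1 *: (cos (0 + i%:R * (2 * pi / 6)), sin (0 + i%:R * (2 * pi / 6))) = hex_vertex i.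
  by rewrite hex_vertexE scale1r add0r.
have mix (t a b : R) : 0 <= t -> t <= 1 -> `|a| <= 1 -> `|b| <= 1 -> `|t * a + (1 - t) * b| <= 1.
  rewrite !ler_norml => t0 t1 /andP[a1 a2] /andP[b1 b2].
  have t1' : 0 <= 1 - t by lra.
  have h1 := ler_wpM2l t0 a1; have h2 := ler_wpM2l t0 a2.
  have h3 := ler_wpM2l t1' b1; have h4 := ler_wpM2l t1' b2.
  by apply/andP; split; lra.
split.
  suff : std_hexagon `<=` S by exact.
  apply: hull_sub.
    move=> y z t t0 t1 [y1 y2 y3] [z1 z2 z3]; split; rewrite !dotD !dotZ; try exact: mix.
    rewrite [X in `|X|](_ : _ = t * (dot u1 y + dot u2 y) + (1 - t) * (dot u1 z + dot u2 z)).
      exact: mix.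
    by ring.
  move=> _ [i _ <-]; rewrite vE.
  have d1 (a b : R) : dot u1 (a, b * s3) = a - b / 2 by rewrite /dot /hex_dual1 /=; field.
  have d2 (a b : R) : dot u2 (a, b * s3) = b by rewrite /dot /hex_dual2 /=; field.
  have S_ab (a b y : R) : y = b * s3 ->
      [/\ `|a - b / 2| <= 1, `|b| <= 1 & `|a - b / 2 + b| <= 1] -> S (a, y).
    by move=> ->; rewrite /S /= d1 d2.
  case: i => -[|[|[|[|[|[|]]]]]] //= _.
  - by apply: (S_ab _ 0); [ring|split; rewrite ler_norml; apply/andP; split; lra].
  - by apply: (S_ab _ 1); [ring|split; rewrite ler_norml; apply/andP; split; lra].
  - by apply: (S_ab _ 1); [ring|split; rewrite ler_norml; apply/andP; split; lra].
  - by apply: (S_ab _ 0); [ring|split; rewrite ler_norml; apply/andP; split; lra].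
  - by apply: (S_ab _ (-1)); [ring|split; rewrite ler_norml; apply/andP; split; lra].
  - by apply: (S_ab _ (-1)); [ring|split; rewrite ler_norml; apply/andP; split; lra].
move=> [h1 h2 h3]; set a := dot u1 x in h1 h3; set b := dot u2 x in h2 h3.
have hv (i : 'I_6) : std_hexagon (hex_vertex i).
  by apply: sub_hull; exists i => //; rewrite vE.
have cH : convex std_hexagon := hull_convex _.
have h0 : std_hexagon 0.
  have := cH _ _ (1 / 2) _ _ (hv (inord 0)) (hv (inord 3)); rewrite !inordK//=.
  have -> : (1 / 2) *: (1, 0) + (1 - 1 / 2) *: (-1, 0) = 0 :> point.
    by rewrite [LHS]surjective_pairing /= /GRing.scale /=; congr (_, _); lra.
  by apply; lra.
have comb (l m : R) y z : std_hexagon y -> std_hexagon z -> 0 <= l -> 0 <= m -> l + m <= 1 ->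
    std_hexagon (l *: y + m *: z).
  move=> hy hz l0 m0 lm; have [E|E] := eqVneq (l + m) 0.
    have -> : l = 0 by lra. have -> : m = 0 by lra.
    by rewrite !scale0r addr0.
  have lm0 : 0 < l + m by rewrite lt_neqAle eq_sym E addr_ge0.
  have -> : l *: y + m *: z = (l + m) *: ((l / (l + m)) *: y + (1 - l / (l + m)) *: z) + (1 - (l + m)) *: 0.
    rewrite scaler0 addr0 [LHS]surjective_pairing [RHS]surjective_pairing /= /GRing.scale /=.
    by congr (_, _); field.
  apply: (cH) => //; first exact: ltW.
  apply: (cH) => //; first by rewrite divr_ge0// ltW.
  by rewrite ler_pdivrMr// mul1r lerDl.
have xE : x = (a + b / 2, b * s3).
  rewrite [x]surjective_pairing; congr (_, _); rewrite /a /b /dot /hex_dual1 /hex_dual2 /=; field => //.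
move: h1 h2 h3; rewrite !ler_norml => /andP[a1 a2] /andP[b1 b2] /andP[c1 c2].
have fin (i j : nat) (l m : R) : (i < 6)%N -> (j < 6)%N -> 0 <= l -> 0 <= m -> l + m <= 1 ->
   (a + b / 2, b * s3) = l *: hex_vertex i + m *: hex_vertex j -> std_hexagon x.
  move=> i6 j6 l0 m0 lm E; rewrite xE E.
  by apply: comb => //; [have := hv (inord i)|have := hv (inord j)]; rewrite inordK.
(* [fin i j] handles the sector between the vertices [i] and [j] *)
have [a0|a0] := leP 0 a; have [b0|b0] := leP 0 b.
- apply: (fin 0 1 a b) => //;
    first [by rewrite [RHS]surjective_pairing /= /GRing.scale /=; congr (_, _); lra|lra].
- have [c0|c0] := leP 0 (a + b).
    apply: (fin 0 5 (a + b) (- b)) => //;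
    first [by rewrite [RHS]surjective_pairing /= /GRing.scale /=; congr (_, _); lra|lra].
  apply: (fin 5 4 a (- (a + b))) => //;
    first [by rewrite [RHS]surjective_pairing /= /GRing.scale /=; congr (_, _); lra|lra].
- have [c0|c0] := leP 0 (a + b).
    apply: (fin 1 2 (a + b) (- a)) => //;
    first [by rewrite [RHS]surjective_pairing /= /GRing.scale /=; congr (_, _); lra|lra].
  apply: (fin 2 3 b (- (a + b))) => //;
    first [by rewrite [RHS]surjective_pairing /= /GRing.scale /=; congr (_, _); lra|lra].
- apply: (fin 3 4 (- a) (- b)) => //;
    first [by rewrite [RHS]surjective_pairing /= /GRing.scale /=; congr (_, _); lra|lra].
Qed.

End HexagonTiling.

(** * The hexagonal lattice *)

Section HexagonLattice.
Context {R : realType}.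
Local Notation point := (R * R)%type.
Implicit Types (A C H K V W : set point) (p q u v w x y : point).
Local Notation th := (@hex_angle R).
Local Notation s3 := (@hex_height R).
Local Notation u1 := (@hex_dual1 R).
Local Notation u2 := (@hex_dual2 R).
Local Notation std_hexagon := (@std_hexagon R).

Lemma hex_coords (a b : R) :
  dot u1 (a + b / 2, b * s3) = a /\ dot u2 (a + b / 2, b * s3) = b.
Proof.
have sn : s3 != 0 by rewrite gt_eqF// sin_pi3_gt0.
by rewrite /dot /hex_dual1 /hex_dual2 /=; split; field.
Qed.

Implicit Type z : int * int.

(** The translations that tile the plane are spanned by the vectors with
    hexagon coordinates [(2, -1)] and [(-1, 2)]. *)
Definition lattice1 z : R := (2 * z.1 - z.2)%:~R.
Definition lattice2 z : R := (2 * z.2 - z.1)%:~R.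
Definition hex_center z : point :=
  (lattice1 z + lattice2 z / 2, lattice2 z * s3).
Definition hex_cell (rho : R) z : set point :=
  homothety (rho *: hex_center z) rho @` std_hexagon.

Lemma hex_cellP rho z x : 0 < rho -> hex_cell rho z x <->
  [/\ `|dot u1 x - rho * lattice1 z| <= rho, `|dot u2 x - rho * lattice2 z| <= rho &
    `|dot u1 x + dot u2 x - rho * (lattice1 z + lattice2 z)| <= rho].
Proof.
move=> r0; have rn : rho != 0 by rewrite gt_eqF.
rewrite /hex_cell homothetyK//= std_hexagonP !dotZ !dotB !dotZ /hex_center.
have [-> ->] := hex_coords (lattice1 z) (lattice2 z).
have E (y : R) : (`|rho^-1 * y| <= 1) = (`|y| <= rho).
  by rewrite normrM gtr0_norm ?invr_gt0// mulrC ler_pdivrMr// mul1r.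
rewrite -mulrDr !E.
have -> : dot u1 x - rho * lattice1 z + (dot u2 x - rho * lattice2 z) =
  dot u1 x + dot u2 x - rho * (lattice1 z + lattice2 z) by ring.
by [].
Qed.

Lemma hex_cell_regular rho z : 0 < rho -> regular_hexagon (hex_cell rho z).
Proof. by move=> r0; apply: regular_hexagon_homothety => //; exact: std_hexagon_regular. Qed.

(** In the basis of the lattice, the point lies in a unit square whose corners
    are lattice points; one of the four hexagons centred at the corners
    contains it. *)
Lemma lattice_cover (a b : R) : exists z : int * int,
  [/\ `|a - lattice1 z| <= 1, `|b - lattice2 z| <= 1 &
   `|a + b - (lattice1 z + lattice2 z)| <= 1].
Proof.
pose s := (2 * a + b) / 3; pose t := (a + 2 * b) / 3.
pose m := Num.floor s; pose n := Num.floor t.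
have [m1 m2] : m%:~R <= s /\ s < m%:~R + 1.
  by have := floor_itv s; rewrite intrD => /andP[].
have [n1 n2] : n%:~R <= t /\ t < n%:~R + 1.
  by have := floor_itv t; rewrite intrD => /andP[].
have aE : a = 2 * s - t by rewrite /s /t; lra.
have bE : b = 2 * t - s by rewrite /s /t; lra.
suff [z Hz] : exists z : int * int,
  [/\ `|2 * s - t - (2 * z.1%:~R - z.2%:~R)| <= 1, `|2 * t - s - (2 * z.2%:~R - z.1%:~R)| <= 1 &
   `|s + t - (z.1%:~R + z.2%:~R)| <= 1].
  exists z; move: Hz; rewrite /lattice1 /lattice2 !intrB !intrM -aE -bE => -[h1 h2 h3].
  split => //; rewrite [X in `|X|](_ : _ = s + t - (z.1%:~R + z.2%:~R))//.
  by rewrite aE bE; ring.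
set x := s - m%:~R; set y := t - n%:~R.
have xE : s = x + m%:~R by rewrite /x subrK.
have yE : t = y + n%:~R by rewrite /y subrK.
have x0 : 0 <= x by rewrite /x subr_ge0.
have y0 : 0 <= y by rewrite /y subr_ge0.
have x1 : x < 1 by rewrite /x ltrBlDl.
have y1 : y < 1 by rewrite /y ltrBlDl.
clearbody x y; rewrite xE yE.
have [c|c] := leP (x + y) 1.
  have [d|d] := leP (2 * x - y) 1; last first.
    by exists (m + 1, n) => /=; rewrite intrD; split; rewrite ler_norml; apply/andP; split; lra.
  have [e|e] := leP (2 * y - x) 1; last first.
    by exists (m, n + 1) => /=; rewrite intrD; split; rewrite ler_norml; apply/andP; split; lra.
  by exists (m, n) => /=; split; rewrite ler_norml; apply/andP; split; lra.
have [d|d] := leP 0 (2 * x - y); last first.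
  by exists (m, n + 1) => /=; rewrite intrD; split; rewrite ler_norml; apply/andP; split; lra.
have [e|e] := leP 0 (2 * y - x); last first.
  by exists (m + 1, n) => /=; rewrite intrD; split; rewrite ler_norml; apply/andP; split; lra.
by exists (m + 1, n + 1) => /=; rewrite !intrD; split; rewrite ler_norml; apply/andP; split; lra.
Qed.

Lemma hex_cell_cover rho x : 0 < rho -> exists z, hex_cell rho z x.
Proof.
move=> r0; have rn : rho != 0 by rewrite gt_eqF.
have [z [h1 h2 h3]] := lattice_cover (dot u1 x / rho) (dot u2 x / rho).
exists z; apply/hex_cellP => //.
have E (a b : R) : `|a / rho - b| <= 1 -> `|a - rho * b| <= rho.
  move=> h; have -> : a - rho * b = rho * (a / rho - b) by field.
  by rewrite normrM gtr0_norm// ler_piMr// ltW.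
by split; apply: E => //; rewrite mulrDl.
Qed.

Lemma hex_cell_measurable rho z : 0 < rho -> plane_measurable (hex_cell rho z).
Proof.
move=> r0; apply: compact_plane_measurable; apply: regular_hexagon_compact.
exact: hex_cell_regular.
Qed.

Lemma hex_cell_area rho z : 0 < rho ->
  area (hex_cell rho z) = rho ^+ 2 * area std_hexagon.
Proof.
move=> r0; apply: area_homothety => //; apply: compact_plane_measurable.
exact: regular_hexagon_compact std_hexagon_regular.
Qed.

Lemma std_hexagon_area_gt0 : 0 < area std_hexagon.
Proof.
have rH := @std_hexagon_regular R; have kH := regular_hexagon_compact _ rH.
apply: area_gt0; [exact: compact_bounded|exact: compact_plane_measurable|].
exists 0; pose S := [set x : point | dot u1 x < 1/2] `&` [set x | dot (- u1) x < 1/2]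
  `&` ([set x | dot u2 x < 1/2] `&` [set x | dot (- u2) x < 1/2]).
have dNl u x : dot (- u) x = - dot u x by rewrite /dot /=; ring.
apply: (interiorS (A := S)).
  move=> x [[/= h1 h2] [/= h3 h4]]; move: h2 h4; rewrite !dNl => h2 h4.
  by apply/std_hexagonP; split; rewrite ler_norml; apply/andP; split; lra.
have oS : open S by apply: openI; apply: openI; exact: open_half_plane.
by apply: oS; split; split; rewrite /= /dot /= !mulr0 addr0; lra.
Qed.

(** Two slabs of the same width whose axes are at least that width apart share
    at most a line. *)
Lemma slab_overlap u (p q rho : R) K K' : u != 0 ->
  plane_measurable K -> plane_measurable K' ->
  (forall x, K x -> `|dot u x - rho * p| <= rho) ->
  (forall x, K' x -> `|dot u x - rho * q| <= rho) -> 0 <= rho ->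
  p + 2 <= q \/ q + 2 <= p -> plane_measure (K `&` K') = 0%E.
Proof.
move=> u0 mK mK' hK hK' r0 pq.
have mKK : plane_measurable (K `&` K') by exact: measurableI.
apply/eqP; rewrite eq_le; apply/andP; split; last exact: measure_ge0.
case: pq => pq.
  rewrite -(line_measure0 u (rho * (p + 1)) u0); apply: le_plane_measure => //.
    exact: line_plane_measurable.
  move=> x [/hK + /hK'] /=; rewrite !ler_norml => /andP[a1 a2] /andP[b1 b2].
  by have := ler_wpM2l r0 pq; lra.
rewrite -(line_measure0 u (rho * (q + 1)) u0); apply: le_plane_measure => //.
  exact: line_plane_measurable.
move=> x [/hK + /hK'] /=; rewrite !ler_norml => /andP[a1 a2] /andP[b1 b2].
by have := ler_wpM2l r0 pq; lra.
Qed.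

(** For distinct lattice points, one of the three coordinates [a], [b], [a +
    b] differs by at least [2]. *)
Lemma hex_cell_overlap rho z z' : 0 < rho -> z != z' ->
  plane_measure (hex_cell rho z `&` hex_cell rho z') = 0%E.
Proof.
move=> r0 zz'; have mz := hex_cell_measurable rho z r0.
have mz' := hex_cell_measurable rho z' r0.
have sn : s3 != 0 by rewrite gt_eqF// sin_pi3_gt0.
have dDl u v x : dot (u + v) x = dot u x + dot v x by rewrite /dot /=; ring.
have toR (a b : int) : (a + 2 <= b \/ b + 2 <= a) -> a%:~R + 2 <= b%:~R :> R \/ b%:~R + 2 <= a%:~R :> R.
  by move=> [h|h]; [left|right]; rewrite -(ler_int R) intrD in h.
have cases : [\/ 2 * z.1 - z.2 + 2 <= 2 * z'.1 - z'.2 \/ 2 * z'.1 - z'.2 + 2 <= 2 * z.1 - z.2,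
   2 * z.2 - z.1 + 2 <= 2 * z'.2 - z'.1 \/ 2 * z'.2 - z'.1 + 2 <= 2 * z.2 - z.1 |
   z.1 + z.2 + 2 <= z'.1 + z'.2 \/ z'.1 + z'.2 + 2 <= z.1 + z.2].
  have : z.1 <> z'.1 \/ z.2 <> z'.2.
    have [E1|/eqP] := eqVneq z.1 z'.1; last by left.
    right => E2; case/eqP: zz'.
    by rewrite [z]surjective_pairing [z']surjective_pairing E1 E2.
  move: z.1 z.2 z'.1 z'.2 => a b c d h.
  have : (2 * a - b + 2 <= 2 * c - d \/ 2 * c - d + 2 <= 2 * a - b) \/
    ((2 * b - a + 2 <= 2 * d - c \/ 2 * d - c + 2 <= 2 * b - a) \/
    (a + b + 2 <= c + d \/ c + d + 2 <= a + b)) by lia.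
  by move=> [?|[?|?]]; [constructor 1|constructor 2|constructor 3].
case: cases => /toR pq.
- apply: (slab_overlap u1 _ _ rho _ _ _ mz mz' _ _ (ltW r0) pq).
  + by apply/eqP => -[] /eqP; rewrite oner_eq0.
  + by move=> x /(hex_cellP _ _ _ r0)[].
  + by move=> x /(hex_cellP _ _ _ r0)[].
- apply: (slab_overlap u2 _ _ rho _ _ _ mz mz' _ _ (ltW r0) pq).
  + by apply/eqP => -[] /eqP; rewrite invr_eq0 (negbTE sn).
  + by move=> x /(hex_cellP _ _ _ r0)[].
  + by move=> x /(hex_cellP _ _ _ r0)[].
- have lat (a : int * int) : lattice1 a + lattice2 a = (a.1 + a.2)%:~R :> R.
    by rewrite /lattice1 /lattice2 -intrD; congr (_%:~R); ring.
  apply: (slab_overlap (u1 + u2) _ _ rho _ _ _ mz mz' _ _ (ltW r0) pq).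
  + by apply/eqP => -[] /eqP; rewrite addr0 oner_eq0.
  + by move=> x /(hex_cellP _ _ _ r0)[_ _]; rewrite dDl lat.
  + by move=> x /(hex_cellP _ _ _ r0)[_ _]; rewrite dDl lat.
Qed.

Lemma hex_cell_diam rho z x y : 0 < rho -> hex_cell rho z x -> hex_cell rho z y ->
  `|x.1 - y.1| <= 4 * rho /\ `|x.2 - y.2| <= 4 * rho.
Proof.
move=> r0 /(hex_cellP _ _ _ r0)[+ + _] /(hex_cellP _ _ _ r0)[+ + _].
have s0 := @sin_pi3_gt0 R; have sn : s3 != 0 by rewrite gt_eqF.
have s1 : s3 <= 1 by exact: sin_le1.
have x1 v : v.1 = dot u1 v + dot u2 v / 2 by rewrite /dot /hex_dual1 /hex_dual2 /=; field.
have x2 v : v.2 = dot u2 v * s3 by rewrite /dot /hex_dual2 /=; field.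
rewrite !(x1 x) !(x1 y) !(x2 x) !(x2 y) -mulrBl !ler_norml.
move=> /andP[a1 a2] /andP[b1 b2] /andP[c1 c2] /andP[d1 d2].
split; first by apply/andP; split; lra.
rewrite -ler_norml normrM (gtr0_norm s0).
apply: (@le_trans _ _ (`|dot u2 x - dot u2 y| * 1)); first by rewrite ler_wpM2l.
by rewrite mulr1 ler_norml; apply/andP; split; lra.
Qed.
End HexagonLattice.

(** * Splitting a cell *)

Section CellSplitting.
Context {R : realType}.
Local Notation point := (R * R)%type.
Implicit Types (A C K V W : set point) (p q u v w x y z : point).

Definition rectangle (a b c d : R) : set point := `[a, b]%classic `*` `[c, d]%classic.

Lemma rectangleE (a b c d : R) x :
  rectangle a b c d x <-> a <= x.1 <= b /\ c <= x.2 <= d.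
Proof. by rewrite /rectangle /= !in_itv. Qed.

Lemma rectangle_convex (a b c d : R) : convex (rectangle a b c d).
Proof.
have mix (l m t y z : R) : 0 <= t -> t <= 1 -> l <= y <= m -> l <= z <= m ->
    l <= t * y + (1 - t) * z <= m.
  move=> t0 t1 /andP[y1 y2] /andP[z1 z2]; have t1' : 0 <= 1 - t by lra.
  have := ler_wpM2l t0 y1; have := ler_wpM2l t0 y2.
  have := ler_wpM2l t1' z1; have := ler_wpM2l t1' z2.
  by move=> h1 h2 h3 h4; apply/andP; split; lra.
move=> x y t t0 t1 /rectangleE[x1 x2] /rectangleE[y1 y2]; apply/rectangleE.
by split; apply: mix.
Qed.

Lemma rectangle_body (a b c d : R) : a < b -> c < d ->
  convex_body (rectangle a b c d).
Proof.
move=> ab cd; split; first by apply/convexP; exact: rectangle_convex.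
  by apply: compact_setX; exact: segment_compact.
exists ((a + b) / 2, (c + d) / 2); apply/interiorP.
exists (Num.min ((b - a) / 2) ((d - c) / 2)).
  by rewrite lt_min; apply/andP; split; lra.
move=> x; rewrite /= !lt_min !ltr_norml => /andP[/andP[h1 h2] _] /andP[_ /andP[h3 h4]].
by apply/rectangleE; split; apply/andP; split; lra.
Qed.

Lemma rectangle_extreme (a b c d : R) : a < b -> c < d ->
  finite_set (extreme (rectangle a b c d)).
Proof.
move=> ab cd; pose V : set point := [set (a, c); (a, d); (b, c); (b, d)].
have -> : rectangle a b c d = convex_hull V.
  apply/seteqP; split.
    move=> x /rectangleE[x1 x2]; apply: (convex_rectangle _ a b c d) => //;
      by [exact: hull_convex|apply: sub_hull; rewrite /V /=; tauto].
  apply: hull_sub; first exact: rectangle_convex.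
  by move=> x [[[]|]|] ->; apply/rectangleE; rewrite /= !lexx ?(ltW ab) ?(ltW cd).
apply: (@sub_finite_set _ _ V); first exact: extreme_hull.
exact: finite_set4.
Qed.

Variables (Omega : set point) (F : set point -> R).
Hypothesis bO : bounded_set Omega.
Hypothesis cO : convex Omega.
Hypothesis F_mono : forall K1 K2, convex_body K1 -> convex_body K2 ->
  K1 `<=` K2 -> F K1 <= F K2.

(** The cut is along the vertical line through an interior point of [K `&`
    Omega]; both halves of [K] are intersections with rectangles. *)
Lemma cut_cell K : convex_body K -> finite_set (extreme K) -> (K `&` Omega)° !=set0 ->
  exists A C, [/\ is_polygon A /\ is_polygon C, K = A `|` C,
    plane_measure (A `&` C) = 0%E, (A `&` Omega)° !=set0 & (C `&` Omega)° !=set0].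
Proof.
move=> bK fK [p /interiorP[r r0 rKO]].
have kK : compact K by case: bK.
have [M M0 KM] := bounded_box _ (compact_bounded kK).
pose c := p.1; pose N := M + `|c| + 1.
have Nc : - N < c /\ c < N.
  have := ler_norm c; have := ler_norm (- c); rewrite normrN /N => h1 h2.
  by split; lra.
have NM : M <= N by rewrite /N; have := normr_ge0 c; lra.
have NN : - N < N by lra.
pose L := rectangle (- N) c (- N) N; pose U := rectangle c N (- N) N.
have bL : convex_body L by apply: rectangle_body => //; case: Nc.
have bU : convex_body U by apply: rectangle_body => //; case: Nc.
have fL : finite_set (extreme L) by apply: rectangle_extreme => //; case: Nc.
have fU : finite_set (extreme U) by apply: rectangle_extreme => //; case: Nc.
have inL x : K x -> x.1 <= c -> L x.
  move=> /KM[] /=; rewrite !in_itv /= => /andP[x1 x2] /andP[x3 x4] xc.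
  by apply/rectangleE; split; apply/andP; split; lra.
have inU x : K x -> c <= x.1 -> U x.
  move=> /KM[] /=; rewrite !in_itv /= => /andP[x1 x2] /andP[x3 x4] xc.
  by apply/rectangleE; split; apply/andP; split; lra.
have intL : ((K `&` L) `&` Omega)° !=set0.
  exists (c - r / 2, p.2); apply/interiorP; exists (r / 2); first lra.
  move=> x /=; rewrite !ltr_norml => /andP[h1 h2] /andP[h3 h4].
  have [Kx Ox] : (K `&` Omega) x.
    by apply: rKO; rewrite ltr_norml; apply/andP; split; rewrite /c in h1 h2 *; lra.
  by split => //; split => //; apply: inL => //; lra.
have intU : ((K `&` U) `&` Omega)° !=set0.
  exists (c + r / 2, p.2); apply/interiorP; exists (r / 2); first lra.
  move=> x /=; rewrite !ltr_norml => /andP[h1 h2] /andP[h3 h4].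
  have [Kx Ox] : (K `&` Omega) x.
    by apply: rKO; rewrite ltr_norml; apply/andP; split; rewrite /c in h1 h2 *; lra.
  by split => //; split => //; apply: inU => //; lra.
have poly B : convex_body B -> finite_set (extreme B) -> ((K `&` B) `&` Omega)° !=set0 ->
    is_polygon (K `&` B).
  move=> bB fB [x ix]; apply/polygonP; split.
    apply: convex_bodyI => //; exists x; move: ix; apply: interiorS.
    exact: subIsetl.
  case: bK bB => cK _ K0 [cB kB B0].
  by apply: finite_extremeI => //; exact/convexP.
exists (K `&` L), (K `&` U); split => //.
- by split; exact: poly.
- apply/seteqP; split; last by move=> x [[]|[]].
  by move=> x Kx; have [h|/ltW h] := leP x.1 c; [left; split => //; exact: inL|right; split => //; exact: inU].
have e10 : (1, 0) != 0 :> point by apply/eqP => -[] /eqP; rewrite oner_eq0.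
apply/eqP; rewrite eq_le; apply/andP; split; last exact: measure_ge0.
rewrite -(line_measure0 (1, 0) c e10); apply: le_plane_measure.
- apply: compact_plane_measurable; apply: compact_closedI.
    by apply: compact_closedI => //; apply: plane_compact_closed; case: bL.
  by apply: closedI; apply: plane_compact_closed => //; case: bU.
- exact: line_plane_measurable.
- move=> x [[_ /rectangleE[/andP[_ h1] _]] [_ /rectangleE[/andP[h2 _] _]]].
  by rewrite /= /dot /=; lra.
Qed.

(** The partitions along which the upper bound is built: splitting a cell
    preserves the bound by monotonicity of [F]. *)
Definition bounded_partition (M : R) k (P : 'I_k -> set point) :=
  convex_partition Omega P /\ forall i, F (closure (P i `&` Omega)) <= M.

(** The cell [ord0] is cut in two; the new cell gets the index [ord_max]. *)
Lemma refine_partition (M : R) k (P : 'I_k.+1 -> set point) :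
  bounded_partition M k.+1 P -> exists P', bounded_partition M k.+2 P'.
Proof.
move=> [[polyP covP disP intP] FM].
have [bP0 fP0] := (polygonP (P ord0)).1 (polyP ord0).
have [A [C [[pA pC] PE mAC iA iC]]] := cut_cell _ bP0 fP0 (intP ord0).
pose par (j : 'I_k.+2) : 'I_k.+1 := odflt ord0 (unlift ord_max j).
pose P' (j : 'I_k.+2) := if unlift ord_max j is Some i then
  (if i == ord0 then A else P i) else C.
have sub j : P' j `<=` P (par j).
  rewrite /P' /par; case: unliftP => [i _|_] /=.
    by case: eqP => [->|_] //; rewrite PE; left.
  by rewrite PE; right.
have polyP' j : is_polygon (P' j).
  by rewrite /P'; case: unliftP => [i _|_] //; case: eqP.
have measP j : plane_measurable (P' j).
  by have /polygonP[[_ /compact_plane_measurable]] := polyP' j.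
have intP' j : (P' j `&` Omega)° !=set0.
  by rewrite /P'; case: unliftP => [i _|_] //; case: eqP => // _; exact: intP.
exists P'; split; last first.
  move=> j; apply: le_trans (FM (par j)); apply: F_mono.
  - apply: closure_body => //; last by apply: bounded_subset bO => x [].
    by apply: convexI => //; apply: body_convex; have /polygonP[] := polyP' j.
  - apply: closure_body => //; last by apply: bounded_subset bO => x [].
    by apply: convexI => //; apply: body_convex; have /polygonP[] := polyP (par j).
  - by apply: closureS => x [/sub ? ?].
split => //.
- apply/seteqP; split; first by move=> x [j _ []].
  rewrite -{1}covP => x [i _ [Pix Ox]].
  have [i0|i0] := eqVneq i ord0; last first.
    by exists (lift ord_max i) => //; split => //; rewrite /P' liftK (negbTE i0).
  move: Pix; rewrite i0 PE => -[Ax|Cx].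
    by exists (lift ord_max ord0) => //; split => //; rewrite /P' liftK eqxx.
  by exists ord_max => //; split => //; rewrite /P' unlift_none.
move=> i j ij; have null0 B : plane_measurable B -> P' i `&` P' j `<=` B ->
    plane_measure B = 0%E -> plane_measure (P' i `&` P' j) = 0%E.
  move=> mB sB B0; apply/eqP; rewrite eq_le; apply/andP; split; last exact: measure_ge0.
  by rewrite -B0; apply: le_plane_measure => //; exact: measurableI (measP i) (measP j).
have mP m : plane_measurable (P m).
  by have /polygonP[[_ /compact_plane_measurable]] := polyP m.
have [pij|pij] := eqVneq (par i) (par j); last first.
  apply: (null0 (P (par i) `&` P (par j))); last exact: disP.
    exact: measurableI (mP _) (mP _).
  by move=> x [/sub ? /sub ?].
have mA : plane_measurable A by have /polygonP[[_ /compact_plane_measurable]] := pA.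
have mC : plane_measurable C by have /polygonP[[_ /compact_plane_measurable]] := pC.
apply: (null0 (A `&` C)) => //; first exact: measurableI mA mC.
move: ij pij; rewrite /P' /par.
case: (unliftP ord_max i) => [i' ->|->]; case: (unliftP ord_max j) => [j' ->|->] //=.
- by move=> /eqP ij ij'; case: ij; rewrite ij'.
- by move=> _ ->; rewrite eqxx.
- by move=> _ <-; rewrite eqxx setIC.
- by rewrite eqxx.
Qed.

Lemma refine_partition_le (M : R) n k (P : 'I_n.+1 -> set point) :
  bounded_partition M n.+1 P -> (n.+1 <= k)%N ->
  exists P' : 'I_k -> set point, bounded_partition M k P'.
Proof.
move=> bP /subnKC <-; elim: (k - n.+1)%N => [|d [P' bP']].
  by rewrite addn0; exists P.
by rewrite addnS; apply: refine_partition bP'.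
Qed.
End CellSplitting.

(** * The upper bound *)

Section UpperBound.
Context {R : realType}.
Local Notation point := (R * R)%type.
Implicit Types (A C H K V W : set point) (p q u v w x y : point).

Lemma bounded_homothety z (t : R) A : bounded_set A ->
  bounded_set (homothety z t @` A).
Proof.
move=> /bounded_box[M M0 AM].
pose N := `|z.1| + `|z.2| + `|t| * M.
have N0 : 0 <= N by rewrite !addr_ge0// mulr_ge0// ltW.
apply: (bounded_subset _ (rectangle (- N) N (- N) N)).
  move=> _ [x Ax <-]; have [] := AM _ Ax; rewrite /= !in_itv /= => x1 x2.
  have tx (s : R) : - M < s < M -> `|t * s| <= `|t| * M.
    move=> /andP[s1 s2]; rewrite normrM ler_wpM2l// ler_norml.
    by apply/andP; split; exact: ltW.
  have b1 := tx _ x1; have b2 := tx _ x2.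
  have := normr_ge0 z.1; have := normr_ge0 z.2 => z20 z10.
  apply/rectangleE; rewrite -!ler_norml /homothety /=; split.
    by apply: le_trans (ler_normD _ _) _; rewrite /N; move: b1; rewrite /GRing.scale /=; lra.
  by apply: le_trans (ler_normD _ _) _; rewrite /N; move: b2; rewrite /GRing.scale /=; lra.
by apply: compact_bounded; apply: compact_setX; exact: segment_compact.
Qed.

Variables (Omega : set point).
Hypothesis bO : bounded_set Omega.
Hypothesis oO : open Omega.
Hypothesis cO : convex Omega.

(** A point of the hexagon differs by less than [eta * r] from a point [x] of
    [Omega]; rescaled by [eta^-1], the difference moves the centre of the ball
    inside [Omega], and the point is the image of a convex combination. *)
Lemma hex_cell_near (rho eta r : R) x0 z : 0 < rho -> 0 < eta ->
  (forall x, `|x.1 - x0.1| < r -> `|x.2 - x0.2| < r -> Omega x) ->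
  4 * rho < eta * r -> (hex_cell rho z `&` Omega) !=set0 ->
  hex_cell rho z `<=` homothety (- eta *: x0) (1 + eta) @` Omega.
Proof.
move=> r0 e0 ball small [x [cx Ox]] y cy.
have [d1 d2] := hex_cell_diam rho z y x r0 cy cx.
have en : eta != 0 by rewrite gt_eqF.
have e1n : 1 + eta != 0 by rewrite gt_eqF// addr_gt0.
pose v := x0 + eta^-1 *: (y - x).
have lt (d : R) : `|d| <= 4 * rho -> `|eta^-1 * d| < r.
  move=> h; rewrite normrM gtr0_norm ?invr_gt0// ltr_pdivrMl//.
  exact: le_lt_trans small.
have Ov : Omega v.
  by apply: ball; rewrite /v /= addrC addKr; exact: lt.
(* [(1 + eta) *: (t *: x + (1 - t) *: v) - eta *: x0] is [y] *)
pose t := (1 + eta)^-1.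
have t0 : 0 <= t by rewrite invr_ge0 addr_ge0// ltW.
have t1 : t <= 1 by rewrite invf_le1 ?addr_gt0// lerDl ltW.
exists (t *: x + (1 - t) *: v); first exact: cO.
rewrite /homothety /v /t [LHS]surjective_pairing [RHS]surjective_pairing /= /GRing.scale /=.
by congr (_, _); field; rewrite en e1n.
Qed.

(** The cells that meet [Omega] lie in a slightly enlarged copy of [Omega] and
    do not overlap, so their total area is at most that of the copy. *)
Lemma hex_cell_count (rho eta r : R) x0 (s : seq (int * int)) : 0 < rho -> 0 < eta ->
  (forall x, `|x.1 - x0.1| < r -> `|x.2 - x0.2| < r -> Omega x) ->
  4 * rho < eta * r -> uniq s ->
  (forall z, z \in s -> (hex_cell rho z `&` Omega) !=set0) ->
  (size s)%:R * (rho ^+ 2 * area (@std_hexagon R)) <= (1 + eta) ^+ 2 * area Omega.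
Proof.
move=> r0 e0 ball small us sO.
have mO := open_plane_measurable _ oO.
have e1 : 0 < 1 + eta by rewrite addr_gt0.
rewrite -(area_homothety (- eta *: x0) (1 + eta) Omega e1 mO).
have -> : (size s)%:R * (rho ^+ 2 * area (@std_hexagon R)) =
    \sum_(i < size s) area (hex_cell rho (nth 0 s i)).
  rewrite (eq_bigr (fun=> rho ^+ 2 * area (@std_hexagon R))) => [|i _].
    by rewrite sumr_const card_ord mulr_natl.
  exact: hex_cell_area.
apply: area_superadd.
- exact: bounded_homothety.
- exact: homothety_measurable.
- by move=> i; exact: hex_cell_measurable.
- by move=> i; apply: (hex_cell_near _ _ r) => //; apply: sO; exact: mem_nth.
- move=> i j ij; apply: hex_cell_overlap => //.
  by rewrite nth_uniq.
Qed.

(** The cells of the lattice that meet [Omega] in a set with interior. The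
    area count [hex_cell_count] shows at once that there are finitely many of
    them and that they are at most [k]. *)
Lemma hexagonal_partition (rho eta r : R) x0 k : 0 < rho -> 0 < eta -> Omega x0 ->
  (forall x, `|x.1 - x0.1| < r -> `|x.2 - x0.2| < r -> Omega x) ->
  4 * rho < eta * r ->
  (1 + eta) ^+ 2 * area Omega < k.+1%:R * (rho ^+ 2 * area (@std_hexagon R)) ->
  exists n (P : 'I_n.+1 -> set point), [/\ (n.+1 <= k)%N, convex_partition Omega P &
    forall i, exists z, P i = hex_cell rho z].
Proof.
move=> r0 e0 Ox0 ball small big.
pose J := [set z : int * int | (hex_cell rho z `&` Omega)° !=set0].
have JO z : J z -> (hex_cell rho z `&` Omega) !=set0.
  by move=> [x /interior_subset ?]; exists x.
have hA : 0 < rho ^+ 2 * area (@std_hexagon R).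
  by rewrite mulr_gt0 ?exprn_gt0//; exact: std_hexagon_area_gt0.
have few (s : seq (int * int)) : uniq s -> (forall z, z \in s -> J z) -> (size s <= k)%N.
  move=> us sJ; rewrite -ltnS -(ltr_nat R) -(ltr_pM2r hA).
  apply: le_lt_trans big.
  by apply: (hex_cell_count _ _ r x0) => // z /sJ /JO.
have /finite_seqP[s0 s0E] : finite_set J.
  apply: contrapT => infJ; have [B BJ Bk] := infinite_set_fset k.+1 infJ.
  have := few _ (finmap.fset_uniq B) (fun z zB => BJ z zB).
  by rewrite leqNgt => /negP; apply.
pose s := undup s0.
have sE z : z \in s <-> J z by rewrite mem_undup s0E.
have us : uniq s by exact: undup_uniq.
have compactz z : compact (hex_cell rho z).
  by apply: regular_hexagon_compact; exact: hex_cell_regular.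
have bodyz z : convex_body (hex_cell rho z).
  by apply: regular_hexagon_body; [exact: hex_cell_regular|rewrite hex_cell_area].
have cov x : Omega x -> exists2 z, z \in s & hex_cell rho z x.
  move=> Ox; have [z zx] := hex_cell_cover rho x r0.
  exists z => //; apply/sE.
  have [cz _ z0] := bodyz z.
  have [y iy Oy] := interior_dense _ x Omega ((convexP _).1 cz) z0 zx (oO x Ox).
  by exists y; rewrite interiorI; split => //; exact: oO.
have s_gt0 : (0 < size s)%N.
  by have [z zs _] := cov _ Ox0; rewrite lt0n size_eq0; apply: contraTneq zs => ->.
have sk : (size s <= k)%N by apply: few => // z /sE.
exists (size s).-1, (fun i => hex_cell rho (nth 0 s i)).
have nthJ (i : 'I_(size s).-1.+1) : nth 0 s i \in s.
  by apply: mem_nth; rewrite (leq_trans (ltn_ord i))// prednK.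
split; [by rewrite prednK| |by move=> i; exists (nth 0 s i)].
split.
- move=> i; apply/polygonP; split => //.
  by apply: regular_hexagon_extreme; exact: hex_cell_regular.
- apply/seteqP; split; first by move=> x [i _ []].
  move=> x clx; apply: contrapT => none.
  have out z : z \in s -> ~ hex_cell rho z x.
    move=> zs zx; apply: none.
    have zi : (index z s < (size s).-1.+1)%N by rewrite prednK// index_mem.
    by exists (Ordinal zi) => //; split => //=; rewrite nth_index.
  have nx : nbhs x [set y | forall i : 'I_(size s).-1.+1, ~ hex_cell rho (nth 0 s i) y].
    suff : \forall y \near nbhs x, forall i : 'I_(size s).-1.+1, ~ hex_cell rho (nth 0 s i) y by [].
    apply: filter_forall => i.
    apply: open_nbhs_nbhs; split; last by apply: out.
    by apply: (@closed_openC _ (hex_cell rho (nth 0 s i))); exact: plane_compact_closed.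
  have [y [Oy ny]] := clx _ nx; have [z zs zy] := cov y Oy.
  have zi : (index z s < (size s).-1.+1)%N by rewrite prednK// index_mem.
  by apply: (ny (Ordinal zi)); rewrite /= nth_index.
- move=> i j ij; apply: hex_cell_overlap => //.
  by rewrite nth_uniq // -[X in (_ < X)%N](prednK s_gt0) ltn_ord.
- by move=> i; apply/sE.
Qed.

Variables (F : set point -> R) (alpha g6 : R).
Hypothesis alpha_gt0 : 0 < alpha.
Hypothesis F_mono : forall K1 K2, convex_body K1 -> convex_body K2 ->
  K1 `<=` K2 -> F K1 <= F K2.
Hypothesis F_homog : forall (t : R) K, 0 < t -> convex_body K ->
  F [set t *: x | x in K] = t `^ alpha * F K.
Hypothesis F_unit : forall H, unit_hexagon H -> g6 = F H.
Hypothesis g6_ge0 : 0 <= g6.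
Hypothesis O0 : Omega !=set0.

(** Take hexagons of area [(1 + eta) ^+ 2 * area Omega / k]. For large [k]
    they are so small that at most [k] of them meet [Omega]. On each cell [F]
    is at most its value on the hexagon, computed by [F_hexagon]; splitting
    cells brings their number to exactly [k]. *)
Lemma upper_bound (eps : R) : 0 < eps ->
  exists k1 : nat, forall k : nat, (k1 <= k)%N ->
    exists (P : 'I_k -> set point) (M : R), bounded_partition Omega F M k P /\
     0 <= M /\ k%:R `^ (alpha / 2) / area Omega `^ (alpha / 2) * M <= g6 + eps.
Proof.
move=> eps0; have [x0 Ox0] := O0.
have /interiorP[r rp ball] : Omega° x0 by exact: oO.
have a20 : 0 < alpha / 2 by rewrite divr_gt0.
have q0 : 0 < 2 / alpha by rewrite divr_gt0.
have AO : 0 < area Omega.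
  by apply: area_gt0 => //; [exact: open_plane_measurable|exists x0; exact: oO].
have Ah := @std_hexagon_area_gt0 R.
(* [g6] may vanish, hence the shift by [1] *)
pose b := 1 + eps / (g6 + 1).
have g1 : 0 < g6 + 1 by rewrite ltr_wpDl.
have b1 : 1 < b by rewrite /b ltrDl divr_gt0.
pose B := b `^ (2 / alpha).
have B1 : 1 < B.
  have -> : 1 = 1 `^ (2 / alpha) :> R by rewrite powR1.
  by apply: gt0_ltr_powR => //; rewrite nnegrE; lra.
(* chosen so that [(1 + eta) ^+ 2 <= 1 + 3 * eta <= B] *)
pose eta := Num.min 1 ((B - 1) / 3).
have eta0 : 0 < eta by rewrite lt_min; apply/andP; split; lra.
have eta1 : eta <= 1 by rewrite ge_min lexx.
have etaB : eta <= (B - 1) / 3 by rewrite ge_min lexx orbT.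
have etaB2 : (1 + eta) ^+ 2 <= B.
  have : eta * eta <= eta by rewrite ler_piMr// ltW.
  by rewrite expr2; lra.
set C := (1 + eta) ^+ 2 * area Omega.
have C0 : 0 < C by rewrite mulr_gt0// exprn_gt0// addr_gt0.
pose D := (eta * r / 4) ^+ 2 * area (@std_hexagon R).
have er0 : 0 < eta * r / 4 by rewrite divr_gt0// mulr_gt0.
have D0 : 0 < D by rewrite mulr_gt0// exprn_gt0.
exists (maxn 1 (Num.bound (C / D))) => k; rewrite geq_max => /andP[k_gt0 kb].
have kp : 0 < k%:R :> R by rewrite ltr0n.
have kD : C < D * k%:R.
  rewrite mulrC -ltr_pdivrMr//; apply: lt_le_trans (archi_boundP _) _.
    by rewrite divr_ge0// ltW.
  by rewrite ler_nat.
pose rho2 := C / (k%:R * area (@std_hexagon R)).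
have rho20 : 0 < rho2 by rewrite divr_gt0// mulr_gt0.
pose rho := Num.sqrt rho2.
have rho0 : 0 < rho by rewrite sqrtr_gt0.
have rhoE : rho ^+ 2 = rho2 by rewrite sqr_sqrtr// ltW.
have hexA : rho ^+ 2 * area (@std_hexagon R) = C / k%:R.
  by rewrite rhoE /rho2; field; rewrite !gt_eqF.
have small : 4 * rho < eta * r.
  have : rho < eta * r / 4.
    rewrite -(ltr_pXn2r (n := 2))// ?nnegrE ?ltW// rhoE /rho2.
    rewrite ltr_pdivrMr ?mulr_gt0//.
    by move: kD; rewrite /D; lra.
  lra.
have big : C < k.+1%:R * (rho ^+ 2 * area (@std_hexagon R)).
  rewrite hexA mulrA ltr_pdivlMr// mulrC ltr_pM2r//.
  by rewrite ltr_nat.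
have [n [P [nk parP hexP]]] := hexagonal_partition rho eta r x0 k rho0 eta0 Ox0 ball small big.
pose M := (C / k%:R) `^ (alpha / 2) * g6.
have bP : bounded_partition Omega F M n.+1 P.
  split => // i; have [z Pz] := hexP i.
  have rz := hex_cell_regular rho z rho0.
  have az := hex_cell_area rho z rho0; rewrite hexA in az.
  have az0 : 0 < area (hex_cell rho z) by rewrite az divr_gt0.
  have bz := regular_hexagon_body _ rz az0.
  have -> : M = F (hex_cell rho z).
    by rewrite (F_hexagon F alpha g6 F_homog F_unit) // az.
  have [_ _ _ intP] := parP.
  apply: F_mono => //.
    apply: closure_body; last exact: intP.
      by apply: convexI => //; apply: body_convex; rewrite Pz.
    by apply: bounded_subset bO => x [].
  rewrite [X in _ `<=` X](closure_id _).1; last by apply: plane_compact_closed; case: bz.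
  by apply: closureS; rewrite Pz; exact: subIsetl.
have [P' bP'] := refine_partition_le Omega F bO cO F_mono M n k P bP nk.
exists P', M; split => //; split; first by rewrite mulr_ge0 ?powR_ge0.
have AOp : 0 < area Omega `^ (alpha / 2) by exact: powR_gt0.
have kpp : 0 < k%:R `^ (alpha / 2) :> R by exact: powR_gt0.
have -> : k%:R `^ (alpha / 2) / area Omega `^ (alpha / 2) * M = ((1 + eta) ^+ 2) `^ (alpha / 2) * g6.
  rewrite /M powRM ?(ltW C0) ?invr_ge0 ?(ltW kp)//.
  rewrite /C powRM ?sqr_ge0 ?(ltW AO)//.
  have -> : (k%:R^-1) `^ (alpha / 2) = (k%:R `^ (alpha / 2))^-1 :> R.
    by rewrite -[k%:R^-1]powR_inv1 ?ler0n// -powRAC powR_inv1// powR_ge0.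
  by field; rewrite !gt_eqF.
apply: (@le_trans _ _ (b * g6)).
  apply: (ler_wpM2r g6_ge0); rewrite -[leRHS](powR_half_inv alpha alpha_gt0) ?(ltW (lt_trans ltr01 b1))//.
  by apply: ge0_ler_powR; rewrite ?nnegrE ?sqr_ge0 ?powR_ge0 ?(ltW a20).
rewrite /b mulrDl mul1r lerD2l mulrAC ler_pdivrMr//.
by rewrite ler_wpM2l ?(ltW eps0)// lerDl.
Qed.
End UpperBound.

(** * The limit *)

Theorem theorem6 (R : realType) (Omega : set (R * R))
    (Omega_open : open Omega)
    (Omega_bounded : bounded_set Omega)
    (Omega_convex : @convex_set R (R * R)%type Omega)
    (Omega_nonempty : Omega !=set0)
    (F : set (R * R) -> R)
    (F_ge0 : forall K, convex_body K -> 0 <= F K)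
    (F_mono : forall K1 K2, convex_body K1 -> convex_body K2 ->
       K1 `<=` K2 -> F K1 <= F K2)
    (alpha : R) (alpha_gt0 : 0 < alpha)
    (F_homog : forall (t : R) K, 0 < t -> convex_body K ->
       F [set t *: x | x in K] = t `^ alpha * F K)
    (gamma : nat -> R)
    (gamma_min : forall n, (3 <= n)%N ->
       is_min [set F P * area P `^ (- (alpha / 2)) | P in @is_ngon R n]
              (gamma n))
    (gamma_6 : forall H, unit_hexagon H -> gamma 6%N = F H)
    (gamma_ext : exists g : R -> R,
       [/\ forall n, (3 <= n)%N -> g n%:R = gamma n,
           {for 6, continuous g} &
           exists (k0 : nat) (delta0 : R), 0 < delta0 /\
             forall (k : nat) (delta : R) (n : 'I_k -> nat),
               (k0 <= k)%N -> 0 < delta -> delta <= delta0 ->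
               (forall i, (3 <= n i)%N) ->
               k%:R^-1 * (\sum_(i < k) (n i)%:R) <= 6 + delta ->
               k%:R^-1 * (\sum_(i < k) g (n i)%:R `^ (- (2 / alpha)))
                 <= g (6 + delta) `^ (- (2 / alpha))])
    (H : set (R * R)) (H_hex : unit_hexagon H) :
  (k%:R `^ (alpha / 2) / area Omega `^ (alpha / 2)
     * minmax_value F Omega k) @[k --> \oo] --> F H.
Proof.
have cO := (convexP Omega).1 Omega_convex.
have aH0 : 0 < area H by rewrite H_hex.2.
have G0 : 0 <= gamma 6%N.
  by rewrite (gamma_6 H H_hex); apply/F_ge0/regular_hexagon_body => //; exact: H_hex.1.
rewrite -(gamma_6 H H_hex).
have AO := area_Omega_gt0 Omega Omega_bounded Omega_open Omega_nonempty.
apply/cvgrPdist_le => /= eps eps0.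
have [k1 upper] := upper_bound Omega Omega_bounded Omega_open cO F alpha (gamma 6%N)
  alpha_gt0 F_mono F_homog gamma_6 G0 Omega_nonempty eps eps0.
have [k2 lower] : exists k2 : nat, forall (k : nat) (P : 'I_k -> set (R * R)) (M : R),
    (k2 <= k)%N -> convex_partition Omega P -> 0 <= M ->
    (forall i, F (closure (P i `&` Omega)) <= M) ->
    gamma 6%N - eps <= k%:R `^ (alpha / 2) / area Omega `^ (alpha / 2) * M.
  (* if [gamma 6 = 0] the lower bound is trivial; otherwise [F] is positive on
     all convex bodies and negative powers of [gamma] can be used *)
  have [G0'|Gp] := eqVneq (gamma 6%N) 0.
    exists 0%N => k P M _ _ M0 _; rewrite G0' sub0r.
    apply: (@le_trans _ _ 0); first by rewrite oppr_le0 ltW.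
    by rewrite mulr_ge0// divr_ge0// powR_ge0.
  have Gpos : 0 < gamma 6%N by rewrite lt_neqAle eq_sym Gp.
  have [g [gE gcont [k0 [delta0 [d0 gconc]]]]] := gamma_ext.
  pose e := Num.min eps (gamma 6%N / 2).
  have e0 : 0 < e by rewrite lt_min eps0 divr_gt0.
  have eG : e < gamma 6%N by rewrite gt_min; apply/orP; right; lra.
  have [k2 k2P] := lower_bound Omega F alpha gamma Omega_bounded Omega_open cO
    Omega_nonempty alpha_gt0 F_mono F_homog gamma_min gamma_6 H g k0 delta0 e
    H_hex Gpos gE gcont d0 gconc e0 eG.
  exists k2 => k P M hk hP M0 FM; apply: le_trans (k2P k P M hk hP M0 FM).
  by rewrite lerD2l lerN2 ge_min lexx.
exists (maxn 1 (maxn k1 k2)) => // k /=; rewrite !geq_max => /and3P[k_gt0 hk1 hk2].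
have [P [M [[parP FM] [M0 PM]]]] := upper k hk1.
set c := k%:R `^ (alpha / 2) / area Omega `^ (alpha / 2) in PM *.
have c0 : 0 < c by rewrite divr_gt0// powR_gt0// ltr0n.
rewrite /minmax_value; set S := [set _ | _ in _].
have S_ge : lbound S ((gamma 6%N - eps) / c).
  move=> _ [P' parP' <-]; rewrite ler_pdivrMr// mulrC.
  apply: (lower k P') => //; last by move=> i; exact: le_bigmax.
  by elim/big_rec: _ => // i x _ x0; rewrite le_max x0 orbT.
have SP : S (\big[Num.max/0]_(i < k) F (closure (P i `&` Omega))) by exists P.
have infM : inf S <= M.
  apply: (@le_trans _ _ (\big[Num.max/0]_(i < k) F (closure (P i `&` Omega)))).
    by apply: ge_inf => //; exists ((gamma 6%N - eps) / c).
  by apply: bigmax_le.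
have infS : (gamma 6%N - eps) / c <= inf S.
  by apply: lb_le_inf => //; exists (\big[Num.max/0]_(i < k) F (closure (P i `&` Omega))).
rewrite ler_norml; apply/andP; split.
  have : c * inf S <= c * M by rewrite ler_wpM2l// ltW.
  lra.
by move: infS; rewrite ler_pdivrMr// [_ * c]mulrC; lra.
Qed.
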